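(* Let $\Omega\subset\mathbb{R}^N$ be a bounded domain with smooth boundary, $\alpha\in\mathbb{R}$, $0\le\beta<2$, and $\alpha+\beta>1$. Then for any weak solution $u\in\mathcal{C}^+_{\phi_{\alpha,\beta}}(\overline{\Omega})$ of $$-\Delta u=\frac{1}{d(x)^\beta u^\alpha}\ \text{ in }\Omega,\qquad u=0\ \text{ on }\partial\Omega,\qquad u>0\ \text{ in }\Omega,$$ there is a constant $c>0$ such that $$|\nabla u(x)|\le c\,d(x)^{\frac{1-\alpha-\beta}{1+\alpha}}\quad\text{for all }x\in\Omega.$$
   Context: $d(x)=\mathrm{dist}(x,\partial\Omega)$. Let $\phi_1>0$ be a first eigenfunction of $-\Delta$ in $\Omega$ with zero Dirichlet boundary condition ($-\Delta\phi_1=\lambda_1\phi_1$ in $\Omega$, $\phi_1=0$ on $\partial\Omega$), and set $\phi_{\alpha,\beta}=\phi_1^{\frac{2-\beta}{1+\alpha}}$ (for $\alpha+\beta>1$). Define $$\mathcal{C}^+_{\phi_{\alpha,\beta}}(\overline{\Omega})=\{v\in C(\overline{\Omega}) : \exists\, c_1,c_2>0 \text{ such that } c_1\phi_{\alpha,\beta}\le v\le c_2\phi_{\alpha,\beta}\text{ a.e. in }\Omega\}.$$ Weak solution means that the equation holds in the sense of distributions in $\Omega$. *)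

(* Defs.v *)
From HB Require Import structures.
From mathcomp Require Import all_boot all_order all_algebra.
From mathcomp Require Import all_classical all_reals all_analysis.

Set Implicit Arguments.
Unset Strict Implicit.
Unset Printing Implicit Defensive.

Import Order.TTheory GRing.Theory Num.Theory.
Import numFieldNormedType.Exports.

Local Open Scope classical_set_scope.
Local Open Scope ring_scope.

(* Lebesgue measure on R^n, carried by n-tuples with the product sigma-algebra:
   lebesgueN 0 is the unit mass at the only point of R^0, and lebesgueN n.+1 is
   the image of (lebesgue_measure x lebesgueN n) under (x, t) |-> x :: t. *)
Section LebesgueN.
Variable R : realType.
Local Notation tupR n := (n.-tuple (measurableTypeR R)).

Definition consT n (p : measurableTypeR R * tupR n) : tupR n.+1 :=
  [the n.+1.-tuple _ of p.1 :: p.2].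

Lemma measurable_consT n : measurable_fun setT (@consT n).
Proof. exact: measurable_cons. Qed.

Definition unconsT n (t : tupR n.+1) : measurableTypeR R * tupR n :=
  (tnth t ord0, [tuple of behead t]).

Lemma measurable_unconsT n : measurable_fun setT (@unconsT n).
Proof.
apply/measurable_fun_pair; first exact: measurable_tnth.
exact: measurable_behead.
Qed.

Lemma consTK n : cancel (@consT n) (@unconsT n).
Proof. by case=> x t; congr pair; apply/val_inj. Qed.

Section Step.
Variables (n : nat) (mu : {sigma_finite_measure set (tupR n) -> \bar R}).

Definition lebesgue_step : set (tupR n.+1) -> \bar R :=
  pushforward (@lebesgue_measure R \x mu)%E (@consT n).

Let step0 : lebesgue_step set0 = 0%E.
Proof. by rewrite /lebesgue_step /pushforward preimage_set0 measure0. Qed.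

Let step_ge0 A : (0 <= lebesgue_step A)%E.
Proof. by rewrite /lebesgue_step /pushforward; exact: measure_ge0. Qed.

Let step_sigma_additive : semi_sigma_additive lebesgue_step.
Proof.
move=> F mF tF mUF; rewrite /lebesgue_step /pushforward preimage_bigcup.
apply: measure_semi_sigma_additive.
- by move=> k; rewrite -[X in measurable X]setTI; exact: measurable_consT.
- apply/trivIsetP => i j _ _ ij; rewrite -preimage_setI.
  by move/trivIsetP : tF => /(_ i j I I ij) ->; rewrite preimage_set0.
- rewrite -preimage_bigcup -[X in measurable X]setTI.
  exact: measurable_consT.
Qed.

HB.instance Definition _ := isMeasure.Build _ _ _ lebesgue_step
  step0 step_ge0 step_sigma_additive.

Let step_sigma_finite : sigma_finite setT lebesgue_step.
Proof.
have /sigma_finiteP[F [TF ndF Foo]] := sigma_finiteT (@lebesgue_measure R).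
have /sigma_finiteP[G [TG ndG Goo]] := sigma_finiteT mu.
exists (fun k => @unconsT n @^-1` (F k `*` G k)).
  apply/esym; rewrite -subTset => t _.
  have [i _ Fi] : (\bigcup_k F k) (tnth t ord0) by rewrite -TF.
  have [j _ Gj] : (\bigcup_k G k) [tuple of behead t] by rewrite -TG.
  exists (maxn i j) => //; split => /=.
    by move: Fi; exact/subsetPset/ndF/leq_maxl.
  by move: Gj; exact/subsetPset/ndG/leq_maxr.
move=> k; have [mF Fk] := Foo k; have [mG Gk] := Goo k; split.
  rewrite -[X in measurable X]setTI; apply: measurable_unconsT => //.
  exact: measurableX.
rewrite /lebesgue_step /pushforward -comp_preimage.
have -> : @unconsT n \o @consT n = id by apply/funext => p; exact: consTK.
by rewrite preimage_id product_measure1E// lte_mul_pinfty// ge0_fin_numE.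
Qed.

HB.instance Definition _ := Measure_isSigmaFinite.Build _ _ _ lebesgue_step
  step_sigma_finite.

End Step.

Fixpoint lebesgueN n : {sigma_finite_measure set (tupR n) -> \bar R} :=
  if n is m.+1 then lebesgue_step (lebesgueN m)
  else dirac ([tuple] : tupR 0).

Lemma lebesgueN_box n (A : 'I_n -> set (measurableTypeR R)) :
  (forall i, measurable (A i)) ->
  lebesgueN n [set t | forall i, A i (tnth t i)] =
  (\prod_(i < n) lebesgue_measure (A i))%E.
Proof.
elim: n A => [|n IH] A mA.
  by rewrite big_ord0 /= diracE mem_set// => -[].
rewrite big_ord_recl -IH//= /lebesgue_step /pushforward.
rewrite -product_measure1E//; last first.
  have -> : [set t : tupR n | forall i, A (lift ord0 i) (tnth t i)] =
            \bigcap_(i in [set: 'I_n]) ((@tnth n _)^~ i @^-1` A (lift ord0 i)).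
    by apply/seteqP; split => [t tA i _|t tA i]; exact: tA.
  apply: fin_bigcap_measurable => // i _; rewrite -[X in measurable X]setTI.
  exact: measurable_tnth.
congr (_ _); apply/seteqP; split => [[x t] /= tA|[x t] [/= Ax At] i].
  split => [|i] /=; first exact: (tA ord0).
  by have := tA (lift ord0 i); rewrite tnthS.
by case: (unliftP ord0 i) => [j ->|->]; rewrite ?tnthS ?tnth0.
Qed.

End LebesgueN.

Section Euclidean.
Variables (R : realType) (N : nat).
Local Notation E := 'rV[R]_N.
Implicit Types (A U Omega : set E) (f g u v phi rho : E -> R) (x p : E).

(* The norm that the library puts on 'rV[R]_N is the sup norm. *)
Definition enorm x : R := Num.sqrt (\sum_(i < N) x 0 i ^+ 2).

Definition rowT (t : N.-tuple (measurableTypeR R)) : E := \row_i tnth t i.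

Definition ae_in Omega (P : E -> Prop) : Prop :=
  {ae @lebesgueN R N, forall t, Omega (rowT t) -> P (rowT t)}.

Definition integralN Omega f : R :=
  \int[@lebesgueN R N]_(t in rowT @^-1` Omega) f (rowT t).

Definition partial (i : 'I_N) f : E -> R := 'D_(delta_mx 0 i) f.

Definition grad f x : E := \row_i partial i f x.

Definition laplacian f x : R := \sum_(i < N) partial i (partial i f) x.

(* partials [:: i1; ...; ik] f = d_i1 (... (d_ik f)) *)
Definition partials (s : seq 'I_N) f : E -> R := foldr partial f s.

Definition C_on (k : nat) U f : Prop :=
  forall (s : seq 'I_N) x, U x ->
    ((size s <= k)%N -> {for x, continuous (partials s f)}) /\
    ((size s < k)%N -> forall i, derivable (partials s f) x (delta_mx 0 i)).

Definition smooth_on U f : Prop := forall k, C_on k U f.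

Definition boundary A : set E := closure A `\` interior A.

Definition bounded_domain Omega : Prop :=
  [/\ Omega !=set0, open Omega, connected Omega & bounded_set Omega].

(* Near each of its points the boundary is a regular level set of a smooth
   function rho, and Omega lies on the side rho < 0. *)
Definition smooth_boundary Omega : Prop :=
  forall p, boundary Omega p -> exists U rho,
    [/\ open_nbhs p U, smooth_on U rho, grad rho p != 0,
        forall x, U x -> (Omega x <-> rho x < 0) &
        forall x, U x -> (boundary Omega x <-> rho x = 0)].

Definition bdist Omega x : R :=
  inf [set enorm (x - y) | y in boundary Omega].

Definition C_closure Omega v : Prop := {within closure Omega, continuous v}.

Definition dirichlet_eigenpair Omega (lambda : R) phi : Prop :=
  [/\ C_closure Omega phi, C_on 2 Omega phi,
      exists2 x, Omega x & phi x != 0,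
      forall x, Omega x -> - laplacian phi x = lambda * phi x &
      forall x, boundary Omega x -> phi x = 0].

Definition positive_first_eigenfunction Omega (lambda1 : R) phi1 : Prop :=
  [/\ dirichlet_eigenpair Omega lambda1 phi1,
      forall mu psi, dirichlet_eigenpair Omega mu psi -> lambda1 <= mu &
      forall x, Omega x -> 0 < phi1 x].

Definition phi_ab (alpha beta : R) phi1 x : R :=
  phi1 x `^ ((2 - beta) / (1 + alpha)).

Definition Cplus Omega phi v : Prop :=
  C_closure Omega v /\
  exists c1 c2 : R, [/\ 0 < c1, 0 < c2 &
    ae_in Omega (fun x => c1 * phi x <= v x <= c2 * phi x)].

Definition test_function Omega phi : Prop :=
  smooth_on setT phi /\
  exists K, [/\ compact K, K `<=` Omega & forall x, ~ K x -> phi x = 0].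

(* - Delta u = f in Omega, in the sense of distributions *)
Definition distributional_poisson Omega u f : Prop :=
  forall phi, test_function Omega phi ->
    integralN Omega (fun x => u x * - laplacian phi x) =
    integralN Omega (fun x => f x * phi x).

Definition weak_solution Omega (alpha beta : R) u : Prop :=
  [/\ distributional_poisson Omega u
        (fun x => 1 / (bdist Omega x `^ beta * u x `^ alpha)),
      forall x, boundary Omega x -> u x = 0 &
      forall x, Omega x -> 0 < u x].

End Euclidean.

(* Main.v *)
Require Import Defs.
From mathcomp Require Import all_boot all_order all_algebra.
From mathcomp Require Import all_classical all_reals all_analysis.
From mathcomp Require Import measurable_realfun.
From mathcomp Require Import ring lra.
Import Order.TTheory GRing.Theory Num.Theory.
Import numFieldNormedType.Exports.
Local Open Scope classical_set_scope.
Local Open Scope ring_scope.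
Set Implicit Arguments.
Unset Strict Implicit.
Unset Printing Implicit Defensive.

(** Why the estimate holds.  Write d for the distance to the boundary and
g = (2 - beta) / (1 + alpha) > 0, so that g - 1 is the exponent in the
conclusion.  The solution u has size d^g by assumption, once the eigenfunction
is known to have size d.  On a cube about x whose half side s is a fixed small
multiple of d x, the distance is comparable to d x, so there u <= A (d x)^g and
the right-hand side is at most K (d x)^(- beta - g alpha) = K (d x)^(g - 2); the
last identity is what singles out g.  A solution of - Delta u = f satisfies
|grad u x| <= C (sup |u| / s + s sup |f|) with suprema over that cube, and both
terms are multiples of (d x)^(g - 1).  Nothing else depends on the singularity of
the equation.  Two facts have to be supplied.

The eigenfunction is comparable to d [eigenfunction_comparable_dist].  The
boundary is locally a regular level set rho = 0 of a smooth function, and for B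
large compared with |A| the function A rho + B rho^2 has a Laplacian as positive
as desired, because Delta (rho^2) = 2 |grad rho|^2 + 2 rho Delta rho.
Adding or subtracting the eigenfunction and subtracting a multiple of
|x - q|^2, with q on the boundary, leaves a function which is subharmonic near q
and nonpositive on the boundary of the intersection of the domain with a small
cube about q, hence nonpositive inside [barrier_comparison].  The two signs give
the upper bound, with q a nearly nearest boundary point, and the lower bound of
Hopf type, with q reached by moving along a coordinate axis.  Compactness of the
closure makes the local constants uniform.

The interior estimate holds for distributional solutions [interior_gradient].
For a C^2 function w and a coordinate i, the antisymmetrization of w under
reflection in the hyperplane y_i = x_i vanishes there, so an explicit quadratic
barrier on a half cube bounds its slope [gradient_estimate].  A distributional
solution is approximated uniformly, together with its right-hand side, by
mollification with a product of one-dimensional bump functions, whose derivatives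
of all orders are known explicitly.  Applied to differences of approximations, the
estimate shows that their gradients converge uniformly; this gives
differentiability of u and transfers the estimate to it. *)

(** * Calculus in one variable and along coordinates *)

Section OneVariable.
Context {R : realType}.
Implicit Types (g dg : R -> R).

Lemma is_derive_continuous g dg t : is_derive (t : R) (1 : R) g (dg t) -> {for t, continuous g}.
Proof.
move=> [gt _]; apply: differentiable_continuous.
by apply/derivable1_diffP.
Qed.

(** The constant c is subtracted so that one statement covers both uses: c = 0
bounds an increment, and c = g' a bounds a first-order Taylor remainder. *)
Lemma mvt_bound g dg (c M a b : R) :
  (forall t : R, Num.min a b <= t <= Num.max a b -> is_derive t 1 g (dg t)) ->
  (forall t, Num.min a b <= t <= Num.max a b -> `|dg t - c| <= M) ->
  `|g b - g a - c * (b - a)| <= M * `|b - a|.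
Proof.
wlog ab : a b / a < b => [hw gd dgM|].
  have [ab|ba|->] := ltgtP a b; first exact: hw.
    rewrite -normrN -(normrN (b - a)).
    have -> : - (g b - g a - c * (b - a)) = g a - g b - c * (a - b) by ring.
    rewrite opprB; apply: hw => // t; rewrite minC maxC; [exact: gd|exact: dgM].
  by rewrite !subrr mulr0 subr0 normr0 mulr0.
rewrite (min_idPl (ltW ab)) (max_idPr (ltW ab)) => gd dgM.
have [||x] := @MVT R g dg a b ab.
- by move=> x /andP[ax xb]; apply: gd; move: ax xb; rewrite !bnd_simp => /ltW -> /ltW ->.
- apply: derivable_within_continuous => x; rewrite in_itv/= => xab.
  by have [] := gd _ xab.
rewrite in_itv/= => /andP[ax xb] ->.
rewrite -mulrBl normrM ler_wpM2r//; apply: dgM.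
by rewrite (ltW ax) (ltW xb).
Qed.

(** If l were positive then dg, which vanishes at the maximum 0, would be
positive just to the right of 0, and by the mean value theorem g would increase
there. *)
Lemma second_derivative_test g dg (l : R) :
  (\forall t \near (0 : R), is_derive (t : R) (1 : R) g (dg t)) -> is_derive (0 : R) 1 dg l ->
  (\forall t \near (0 : R), g t <= g 0) -> l <= 0.
Proof.
move=> gd [dgd dgl] gmax; rewrite leNgt; apply/negP => l0.
have [e e0 he] : exists2 e : R, 0 < e & forall t : R, `|t| < e ->
    is_derive t 1 g (dg t) /\ g t <= g 0.
  have /nbhs_ballP[e /= e0 he] : \forall t \near (0 : R),
      is_derive (t : R) (1 : R) g (dg t) /\ g t <= g 0.
    by near=> t; split; near: t.
  by exists e => // t te; apply: he; rewrite /ball/= sub0r normrN.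
have dg0 : dg 0 = 0.
  have h : - (e/2) <= (e/2) by lra.
  have [] := @derive1_at_max R g (-(e/2)) (e/2) 0 h.
  - by move=> t; rewrite in_itv/= => /andP[? ?]; have [|[]] := he t; first by rewrite ltr_norml; lra.
  - by rewrite in_itv/=; lra.
  - by move=> t; rewrite in_itv/= => /andP[? ?]; have [|_] := he t; first by rewrite ltr_norml; lra.
  move=> _ h0; have [|[_ <-] _ //] := he 0; first by rewrite normr0.
have hlim : (fun h : R => h^-1 * (dg h)) @ 0^' --> l.
  move: dgd; rewrite /derivable -dgl /derive => hc.
  have -> : (fun h : R => h^-1 * dg h) = (fun h : R => h^-1 *: ((dg \o shift 0) (h *: 1) - dg 0)).
    by apply/funext => h /=; rewrite addr0 dg0 subr0 /GRing.scale/= mulr1.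
  exact: hc.
have /hlim /nbhs_ballP[d /= d0 hd] : nbhs l [set x | 0 < x].
  by apply: open_nbhs_nbhs; split => //; exact: open_gt.
pose t := Num.min (e/2) (d/2).
have t0 : 0 < t by rewrite lt_min; lra.
have te : t <= e/2 by rewrite ge_min lexx.
have td : t <= d/2 by rewrite ge_min lexx orbT.
have [||x] := @MVT R g dg 0 t t0.
- move=> x; rewrite in_itv/= => /andP[x0 xt]; have [|//] := he x.
  by rewrite gtr0_norm//; lra.
- apply: derivable_within_continuous => x; rewrite in_itv/= => /andP[x0 xt].
  by have [|[]] := he x; first by rewrite ger0_norm//; lra.
rewrite in_itv/= => /andP[x0 xt]; rewrite subr0.
have : 0 < x^-1 * dg x.
  by apply: hd; rewrite /ball/= ?sub0r ?normrN ?gtr0_norm ?gt_eqF//; lra.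
rewrite pmulr_rgt0 ?invr_gt0// => dgx.
have [|_] := he t; first by rewrite gtr0_norm//; lra.
have := mulr_gt0 dgx t0; lra.
Unshelve. all: end_near. Qed.

End OneVariable.

Section Coordinates.
Context {R : realType} {N : nat}.
Local Notation E := 'rV[R]_N.
Local Notation e_ i := (delta_mx (0 : 'I_1) i : E).
Implicit Types (f : E -> R) (x y z : E) (i j : 'I_N) (U K : set E).

Lemma is_derive_line f x (v : E) (l t : R) :
  is_derive (x + t *: v) v f l -> is_derive t 1 (fun s => f (x + s *: v)) l.
Proof.
have h : (fun h : R => h^-1 *: (((fun s => f (x + s *: v)) \o shift t) (h *: 1)
      - f (x + t *: v))) =
   (fun h : R => h^-1 *: ((f \o shift (x + t *: v)) (h *: v) - f (x + t *: v))).
  apply/funext => h /=; congr (_ *: (f _ - _)).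
  by rewrite [h *: 1]mulr1 scalerDl addrCA.
by move=> [fd <-]; apply: DeriveDef; rewrite /derivable /derive h.
Qed.

Definition cube x (r : R) : set E := [set y | forall j, `|y 0 j - x 0 j| <= r].

Lemma cube_center x (r : R) : 0 <= r -> cube x r x.
Proof. by move=> r0 j; rewrite subrr normr0. Qed.

Lemma cubeW x r s : r <= s -> cube x r `<=` cube x s.
Proof. by move=> rs y yx j; exact: le_trans rs. Qed.

Lemma cube_sym x r y : cube x r y -> cube y r x.
Proof. by move=> h j; rewrite distrC. Qed.

Lemma cube_trans x y z r s : cube x r y -> cube y s z -> cube x (r + s) z.
Proof.
move=> h k j; have -> : z 0 j - x 0 j = (y 0 j - x 0 j) + (z 0 j - y 0 j) by ring.
by rewrite (le_trans (ler_normD _ _))// lerD.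
Qed.

Lemma nbhs_cube x (r : R) : 0 < r -> nbhs x (cube x r).
Proof.
move=> r0; apply/nbhs_ballP; exists r => //= y [_ xy] j.
by rewrite distrC; exact/ltW/xy.
Qed.

Lemma nbhs_cubeP x (A : set E) : nbhs x A -> exists2 r : R, 0 < r & cube x r `<=` A.
Proof.
move=> /nbhs_ballP[r /= r0 hr]; exists (r / 2); first lra.
move=> y yx; apply: hr; split => // i j.
rewrite ord1 /ball/= distrC (le_lt_trans (yx j))//; lra.
Qed.

Lemma cube_compact x r : compact (cube x r).
Proof.
have -> : cube x r = [set y | forall j, `[x 0 j - r, x 0 j + r]%classic (y 0 j)].
  apply/seteqP; split=> y h j; have := h j; rewrite /= in_itv/= ler_norml; lra.
exact: (@rV_compact R N (fun j => `[x 0 j - r, x 0 j + r]%classic) (fun j => @segment_compact R _ _)).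
Qed.

Lemma cube_closed x r : closed (cube x r).
Proof. by apply: (@compact_closed E); [exact: norm_hausdorff|exact: cube_compact]. Qed.

Lemma shift_coordE (z : E) (a : R) i j : (z + a *: e_ i) 0 j = z 0 j + (j == i)%:R * a.
Proof. by rewrite !mxE eqxx/= mulrC. Qed.

(** The path from x to y that changes one coordinate at a time stays in the
cube, and the one-variable bound applies to each of its steps. *)
Lemma coord_mvt f (D : 'I_N -> E -> R) (c M : 'I_N -> R) x r :
  (forall z, cube x r z -> forall i, is_derive z (e_ i) f (D i z)) ->
  (forall z, cube x r z -> forall i, `|D i z - c i| <= M i) ->
  forall y, cube x r y ->
  `|f y - f x - \sum_i c i * (y 0 i - x 0 i)| <= \sum_i M i * `|y 0 i - x 0 i|.
Proof.
move=> fd DM y xy.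
(* z k has the first k coordinates of y and the remaining ones of x *)
pose z k : E := \row_(j < N) if (j < k)%N then y 0 j else x 0 j.
have z0 : z 0%N = x by apply/rowP => j; rewrite mxE.
have zN : z N = y by apply/rowP => j; rewrite mxE ltn_ord.
have zS (k : 'I_N) : z k.+1 = z k + (y 0 k - x 0 k) *: e_ k.
  apply/rowP => j; rewrite shift_coordE !mxE ltnS leq_eqVlt -(inj_eq val_inj)/=.
  case: eqVneq => [/= jk|_] /=; last by rewrite mul0r addr0.
  by rewrite jk ltnn (val_inj jk); ring.
have zc (k : 'I_N) t : Num.min 0 (y 0 k - x 0 k) <= t <= Num.max 0 (y 0 k - x 0 k) ->
    cube x r (z k + t *: e_ k).
  move=> ht j; rewrite shift_coordE mxE -(inj_eq val_inj)/=.
  have := xy j; case: eqVneq => [jk|_].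
    rewrite jk ltnn (val_inj jk) => h; move: ht h.
    have -> : x 0 k + 1%:R * t - x 0 k = t by ring.
    rewrite ge_min le_max !ler_norml; lra.
  case: ifP => _ h; first by rewrite mul0r addr0.
  rewrite mul0r addr0 subrr normr0; exact: le_trans h.
rewrite -zN -z0 -(telescope_sumr (fun k => f (z k)))// big_mkord zN z0.
rewrite -sumrB (le_trans (ler_norm_sum _ _ _))//; apply: ler_sum => k _.
have := @mvt_bound R (fun t => f (z k + t *: e_ k)) (fun t => D k (z k + t *: e_ k))
  (c k) (M k) 0 (y 0 k - x 0 k).
rewrite scale0r addr0 subr0 zS; apply.
  by move=> t ht; apply: is_derive_line; apply: fd; exact: zc.
by move=> t ht; apply: DM; exact: zc.
Qed.

(** D and H are the first and the pure second partial derivatives of f on U.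
Mixed derivatives are left out: the Laplacian does not see them, and the class is
closed under all the operations used to build barriers. *)
Definition pjet U f (D H : 'I_N -> E -> R) : Prop :=
  forall x, U x -> forall i,
    is_derive x (e_ i) f (D i x) /\ is_derive x (e_ i) (D i) (H i x).

Lemma pjet_max U f D H x : open U -> pjet U f D H -> U x ->
  (forall y, U y -> f y <= f x) -> forall i, H i x <= 0.
Proof.
move=> oU fj Ux fx i.
have near0 : \forall t \near (0 : R), U (x + t *: e_ i).
  have [r r0 hr] := @nbhs_cubeP x U (open_nbhs_nbhs (conj oU Ux)).
  apply/nbhs_ballP; exists r => //= t; rewrite /ball/= sub0r normrN => tr.
  apply: hr => j; rewrite shift_coordE addrAC subrr add0r normrM.
  rewrite -[leRHS]mul1r ler_pM ?(ltW tr)//.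
  by case: (j == i); rewrite ?normr1 ?normr0.
apply: (@second_derivative_test R (fun t => f (x + t *: e_ i))
  (fun t => D i (x + t *: e_ i))).
- near=> t; apply: is_derive_line; apply: (fj _ _ i).1; near: t; exact: near0.
- by apply: is_derive_line; rewrite scale0r addr0; exact: (fj _ _ i).2.
- by near=> t; rewrite scale0r addr0; apply: fx; near: t; exact: near0.
Unshelve. all: end_near. Qed.

(** At a positive maximum inside U all pure second derivatives would be
nonpositive, against the strict positivity of their sum. *)
Lemma max_principle K U f D H : compact K -> open U -> U `<=` K ->
  {within K, continuous f} -> pjet U f D H ->
  (forall x, U x -> 0 < \sum_i H i x) ->
  (forall x, K x -> ~ U x -> f x <= 0) ->
  forall x, K x -> f x <= 0.
Proof.
move=> cK oU UK fc fj Hpos fbd x Kx.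
have [|p] := @compact_EVT_max _ R f K _ cK fc; first by exists x.
rewrite inE => Kp pmax.
have fxp : f x <= f p by apply: pmax; rewrite inE.
apply: (le_trans fxp); apply: contrapT => /negP; rewrite -ltNge => fp.
have [Up|/(fbd _ Kp)] := pselect (U p); last by rewrite leNgt fp.
have := Hpos _ Up; apply/negP; rewrite -leNgt; apply: sumr_le0 => i _.
apply: (pjet_max oU fj Up) => y Uy; apply: pmax; rewrite inE; exact: UK.
Qed.

End Coordinates.

(** * Pure second derivatives and quadratic polynomials *)

Section IsDeriveExplicit.
Context {R : realType} {V : normedModType R}.
Implicit Types (f g : V -> R) (x v : V).

Lemma is_derive_addf f g x v (a b : R) : is_derive x v f a -> is_derive x v g b ->
  is_derive x v (fun y => f y + g y) (a + b).
Proof. by move=> ? ?; apply: is_deriveD. Qed.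

Lemma is_derive_scalef f x v (c a : R) : is_derive x v f a ->
  is_derive x v (fun y => c * f y) (c * a).
Proof. by move=> ?; apply: is_deriveZ. Qed.

Lemma is_derive_mulf f g x v (a b : R) : is_derive x v f a -> is_derive x v g b ->
  is_derive x v (fun y => f y * g y) (f x * b + g x * a).
Proof. by move=> ? ?; apply: is_deriveM. Qed.

Lemma is_derive_lineP f x v (l : R) :
  is_derive (0 : R) 1 (fun s : R => f (x + s *: v)) l -> is_derive x v f l.
Proof.
have h : (fun h : R => h^-1 *: (((fun s => f (x + s *: v)) \o shift 0) (h *: 1)
      - f (x + 0 *: v))) =
   (fun h : R => h^-1 *: ((f \o shift x) (h *: v) - f x)).
  apply/funext => h /=; congr (_ *: (f _ - f _)).
    by rewrite addr0 [h *: 1]mulr1 addrC.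
  by rewrite scale0r addr0.
by move=> [fd <-]; apply: DeriveDef; rewrite /derivable /derive -h.
Qed.

End IsDeriveExplicit.

Section ContinuityExplicit.
Context {R : realType} {T : topologicalType}.
Implicit Types (x : T).

Lemma cts_addf {W : normedModType R} (f g : T -> W) x : {for x, continuous f} -> {for x, continuous g} ->
  {for x, continuous (fun y => f y + g y)}.
Proof. by move=> ? ?; exact: cvgD. Qed.

Lemma cts_mulf (f g : T -> R) x : {for x, continuous f} -> {for x, continuous g} ->
  {for x, continuous (fun y => f y * g y)}.
Proof. by move=> ? ?; exact: cvgM. Qed.

Lemma cts_scalef (c : R) (f : T -> R) x : {for x, continuous f} ->
  {for x, continuous (fun y => c * f y)}.
Proof. by move=> ?; exact: cvgMl_tmp. Qed.

Lemma cts_cstf {W : normedModType R} (c : W) x : {for x, continuous (fun=> c)}.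
Proof. exact: cvg_cst. Qed.

Lemma cts_sumf (I : finType) (f : I -> T -> R) x : (forall i, {for x, continuous (f i)}) ->
  {for x, continuous (fun y => \sum_i f i y)}.
Proof.
move=> fc; rewrite (_ : (fun _ => _) = \sum_i f i); last first.
  by apply/funext => y; rewrite fct_sumE.
apply: (big_ind (fun f : T -> R => {for x, continuous f})).
- exact: (@cts_cstf R 0).
- by move=> g h gc hc; exact: cts_addf.
- by move=> i _; exact: fc.
Qed.

End ContinuityExplicit.

Section Jets.
Context {R : realType} {N : nat}.
Local Notation E := 'rV[R]_N.
Local Notation e_ i := (delta_mx (0 : 'I_1) i : E).
Implicit Types (f g : E -> R) (D H : 'I_N -> E -> R) (x y z : E) (i j : 'I_N) (U : set E).

Lemma pjet_add U f D H g D' H' : pjet U f D H -> pjet U g D' H' ->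
  pjet U (fun x => f x + g x) (fun i x => D i x + D' i x)
    (fun i x => H i x + H' i x).
Proof.
move=> fj gj x Ux i; have [? ?] := fj x Ux i; have [? ?] := gj x Ux i.
by split; apply: is_derive_addf.
Qed.

Lemma pjet_scale U (c : R) f D H : pjet U f D H ->
  pjet U (fun x => c * f x) (fun i x => c * D i x) (fun i x => c * H i x).
Proof.
by move=> fj x Ux i; have [? ?] := fj x Ux i; split; apply: is_derive_scalef.
Qed.

Lemma pjet_sq U f D H : pjet U f D H ->
  pjet U (fun x => f x * f x) (fun i x => 2 * (f x * D i x))
    (fun i x => 2 * (D i x * D i x + f x * H i x)).
Proof.
move=> fj x Ux i; have [h1 h2] := fj x Ux i; split.
  by apply: (is_derive_eq (is_derive_mulf h1 h1)); ring.
by apply: (is_derive_eq (is_derive_scalef 2 (is_derive_mulf h1 h2))); ring.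
Qed.

Lemma pjet_sub_set U U' f D H : U' `<=` U -> pjet U f D H -> pjet U' f D H.
Proof. by move=> U'U fj x /U'U; exact: fj. Qed.

Lemma is_derive_coord (p : R -> R) j i x (l : R) : is_derive (x 0 j) (1 : R) p l ->
  is_derive x (e_ i) (fun y => p (y 0 j)) ((j == i)%:R * l).
Proof.
move=> pd; apply: is_derive_lineP.
have -> : (fun s : R => p ((x + s *: e_ i) 0 j)) =
          p \o (fun s => x 0 j + (j == i)%:R * s).
  by apply/funext => s /=; rewrite shift_coordE.
rewrite mulrC; apply: is_derive1_comp; first by rewrite mulr0 addr0.
apply: (is_derive_eq (is_derive_addf (is_derive_cst (x 0 j) _ _)
  (is_derive_scalef (j == i)%:R (is_derive_id _ _)))).
by rewrite add0r mulr1.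
Qed.

(** Each coordinate has its own coefficients because the barrier for the i-th
partial derivative treats the i-th coordinate differently from the others. *)
Definition quadratic (A B : 'I_N -> R) x y : R :=
  \sum_j (A j * (y 0 j - x 0 j) ^+ 2 + B j * (y 0 j - x 0 j)).

Lemma is_derive_affine (a b t : R) : is_derive t (1 : R) (fun s : R => a * s + b) a.
Proof.
apply: (is_derive_eq (is_derive_addf (is_derive_scalef a (is_derive_id _ _))
  (is_derive_cst b _ _))).
by rewrite addr0 mulr1.
Qed.

Lemma pjet_quadratic U A B x : pjet U (quadratic A B x)
  (fun i y => 2 * A i * (y 0 i - x 0 i) + B i) (fun i _ => 2 * A i).
Proof.
move=> y _ i; split; last first.
  have h := @is_derive_coord (fun t => 2 * A i * t + (B i - 2 * A i * x 0 i)) i i y _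
    (is_derive_affine _ _ _).
  rewrite eqxx mul1r in h.
  rewrite (_ : (fun _ => _) = (fun t : E => 2 * A i * (t 0 i - x 0 i) + B i)) in h; first exact: h.
  by apply/funext => t; ring.
have -> : quadratic A B x =
   \sum_j (fun y : E => A j * (y 0 j - x 0 j) ^+ 2 + B j * (y 0 j - x 0 j)).
  by apply/funext => z; rewrite fct_sumE.
apply: is_derive_eq; first apply: is_derive_sum => j.
  apply: (@is_derive_coord (fun t => A j * (t - x 0 j) ^+ 2 + B j * (t - x 0 j)) j i y
    (2 * A j * (y 0 j - x 0 j) + B j)).
  have h (c b t : R) : is_derive t (1 : R) (fun t => b * (t - c)) b.
    have := is_derive_affine b (- b * c) t.
    by rewrite (_ : (fun _ => _) = (fun t => b * (t - c)))//; apply/funext => u; ring.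
  have h1 t : is_derive t (1 : R) (fun t => (t - x 0 j)) 1.
    by have := h (x 0 j) 1 t; under eq_fun do rewrite mul1r.
  apply: (is_derive_eq (is_derive_addf
    (is_derive_scalef (A j) (is_derive_mulf (h1 _) (h1 _))) (h (x 0 j) (B j) _))).
  ring.
rewrite (bigD1 i)//= eqxx mul1r big1 ?addr0// => j /negPf ->.
by rewrite mul0r.
Qed.

(** Reflection in the hyperplane through x orthogonal to the i-th axis. *)
Definition reflect i x y : E := y + (-2 * (y 0 i - x 0 i)) *: e_ i.

Lemma reflectE i x y j : reflect i x y 0 j = if j == i then 2 * x 0 i - y 0 i else y 0 j.
Proof. by rewrite shift_coordE; case: eqVneq => [->|_] /=; ring. Qed.

Lemma is_derive_reflect f i x y j (l : R) : is_derive (reflect i x y) (e_ j) f l ->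
  is_derive y (e_ j) (fun z => f (reflect i x z)) ((-1) ^+ (j == i) * l).
Proof.
move=> fd; apply: is_derive_lineP.
have -> : (fun s : R => f (reflect i x (y + s *: e_ j))) =
    (fun t => f (reflect i x y + t *: e_ j)) \o (fun s : R => (-1) ^+ (j == i) * s + 0).
  apply/funext => s /=; congr f; apply/rowP => k.
  rewrite reflectE [RHS]shift_coordE reflectE !shift_coordE addr0 [j == i]eq_sym.
  case: (eqVneq k i) => [->|ki]; first by case: eqVneq => _ /=; ring.
  case: (eqVneq i j) => [<-|_]; first by rewrite (negPf ki) /=; ring.
  by rewrite expr0; ring.
rewrite mulrC; apply: is_derive1_comp; last exact: is_derive_affine.
by apply: is_derive_line; rewrite mulr0 addr0 scale0r addr0.
Qed.

Lemma pjet_reflect f D H i x : pjet setT f D H ->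
  pjet setT (fun y => f (reflect i x y)) (fun j y => (-1) ^+ (j == i) * D j (reflect i x y))
    (fun j y => H j (reflect i x y)).
Proof.
move=> fj y _ j; have [? ?] := fj (reflect i x y) I j; split.
  exact: is_derive_reflect.
apply: (is_derive_eq (is_derive_scalef _ (is_derive_reflect _))).
by rewrite mulrA -exprMn mulrNN mulr1 expr1n mul1r.
Qed.

Lemma cube_reflect i x r y : cube x r y -> cube x r (reflect i x y).
Proof.
move=> h j; rewrite reflectE; case: eqVneq => [->|_]; last exact: h.
have -> : 2 * x 0 i - y 0 i - x 0 i = - (y 0 i - x 0 i) by ring.
by rewrite normrN.
Qed.

Lemma cts_coord x i : {for x, continuous (fun y : E => y 0 i)}.
Proof. exact: coord_continuous. Qed.

Lemma continuous_reflect i x : continuous (reflect i x).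
Proof.
move=> y; rewrite /reflect.
apply: (@cts_addf R E E (fun y => y) (fun y => (-2 * (y 0 i - x 0 i)) *: e_ i)).
  exact: cvg_id.
have h : {for y, continuous (fun z : E => -2 * (z 0 i - x 0 i))}.
  by apply: cts_scalef; apply: cts_addf; [exact: cts_coord|exact: cts_cstf].
exact: (cvgZr_tmp h).
Qed.

Lemma continuous_quadratic A B x : continuous (quadratic A B x).
Proof.
move=> y; apply: cts_sumf => j.
have h : {for y, continuous (fun z : E => z 0 j - x 0 j)}.
  by apply: cts_addf; [exact: cts_coord|exact: cts_cstf].
by apply: cts_addf; apply: cts_scalef => //; exact: cts_mulf.
Qed.

(** A function lying below a parabola on the right of a common zero cannot
have a larger slope there: this is how a barrier bounds a derivative. *)
Lemma is_derive_le_quadratic (g : R -> R) (l A B r : R) : 0 < r -> g 0 = 0 ->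
  is_derive (0 : R) 1 g l -> (forall s, 0 < s <= r -> g s <= A * s ^+ 2 + B * s) ->
  l <= B.
Proof.
move=> r0 g0 [gd gl] gle; rewrite leNgt; apply/negP => Bl.
have e0 : 0 < (l - B) / 2 by lra.
have hlim : (fun h : R => h^-1 * g h) @ 0^' --> l.
  move: gd; rewrite /derivable -gl /derive => hc.
  have -> : (fun h : R => h^-1 * g h) = (fun h : R => h^-1 *: ((g \o shift 0) (h *: 1) - g 0)).
    by apply/funext => h /=; rewrite addr0 g0 subr0 /GRing.scale/= mulr1.
  exact: hc.
have /hlim /nbhs_ballP[d /= d0 hd] := nbhsx_ballx l _ e0.
pose m := (l - B) / (2 * (`|A| + 1)).
have A1 : 0 < `|A| + 1 by have := normr_ge0 A; lra.
have m0 : 0 < m by rewrite divr_gt0//; lra.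
pose s := Num.min (Num.min r (d / 2)) m.
have s0 : 0 < s by rewrite !lt_min; lra.
have sr : s <= r by rewrite !ge_min lexx.
have sd : s <= d / 2 by rewrite !ge_min lexx orbT.
have sm : s <= m by rewrite !ge_min lexx orbT.
have /ltr_distlBl : `|l - s^-1 * g s| < (l - B) / 2.
  by apply: hd; rewrite /ball/= ?sub0r ?normrN ?gtr0_norm ?gt_eqF//; lra.
apply/negP; rewrite -leNgt.
have : s^-1 * g s <= A * s + B.
  rewrite mulrC ler_pdivrMr//.
  have -> : (A * s + B) * s = A * s ^+ 2 + B * s by ring.
  by apply: gle; rewrite s0.
have : (`|A| + 1) * s <= (l - B) / 2.
  rewrite mulrC -ler_pdivlMr//; apply: (le_trans sm).
  by rewrite /m invfM mulrA.
have : A * s <= `|A| * s by rewrite ler_wpM2r ?ler_norm// ltW.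
lra.
Qed.

End Jets.

(** * The gradient estimate for functions with bounded Laplacian *)

Section GradientEstimate.
Context {R : realType} {N : nat}.
Local Notation E := 'rV[R]_N.
Local Notation e_ i := (delta_mx (0 : 'I_1) i : E).

Lemma coord_open i (A : set R) : open A -> open [set y : E | A (y 0 i)].
Proof.
move=> oA; apply: (@open_comp _ _ (fun y : E => y 0 i)) => // y _.
exact: coord_continuous.
Qed.

(** Halving the difference between w and its reflection gives a function phi with
derivative D i x in the i-th direction at x, vanishing on the hyperplane y_i = x_i.
With t = y_i - x_i it is compared, on the half cube t >= 0, with
  M / r^2 (sum_(j <> i) (y_j - x_j)^2 + t (N r - (N - 1) t)) + K / 2 t (r - t).
This barrier has Laplacian - K, is nonnegative, is at least M on the faces of the
cube away from the hyperplane, and has slope N M / r + r K / 2 at x. *)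
Lemma gradient_estimate_le (w : E -> R) D H (x : E) (r M K : R) i : 0 < r ->
  pjet setT w D H -> continuous w ->
  (forall y, cube x r y -> `|w y| <= M) ->
  (forall y, cube x r y -> `|\sum_j H j y| < K) ->
  D i x <= N%:R * M / r + r * K / 2.
Proof.
move=> r0 wj wc wM HK.
have M0 : 0 <= M by apply: le_trans (wM x _); [exact: normr_ge0|exact: cube_center (ltW r0)].
have K0 : 0 < K by apply: le_lt_trans (HK x _); [exact: normr_ge0|exact: cube_center (ltW r0)].
pose a := M / r ^+ 2.
have a0 : 0 <= a by rewrite divr_ge0// sqr_ge0.
pose A (j : 'I_N) := if j == i then - (N%:R - 1) * a - K / 2 else a.
pose B (j : 'I_N) := if j == i then N%:R * M / r + r * K / 2 else 0.
pose phi y := 2^-1 * (w y + (-1) * w (reflect i x y)).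
pose f y := phi y + (-1) * quadratic A B x y.
pose Kp := cube x r `&` [set y : E | x 0 i <= y 0 i].
pose U := [set y : E | (forall j, `|y 0 j - x 0 j| < r) /\ x 0 i < y 0 i].
have phij := pjet_scale 2^-1 (pjet_add wj (pjet_scale (-1) (pjet_reflect i x wj))).
have fj := pjet_add phij (pjet_scale (-1) (@pjet_quadratic R N setT A B x)).
have N1 : 1 <= N%:R :> R by rewrite ler1n (leq_ltn_trans _ (ltn_ord i)).
have quadE y : quadratic A B x y =
   \sum_(j | j != i) a * (y 0 j - x 0 j) ^+ 2 +
   (a * (y 0 i - x 0 i) * (N%:R * r - (N%:R - 1) * (y 0 i - x 0 i)) +
   K / 2 * (y 0 i - x 0 i) * (r - (y 0 i - x 0 i))).
  rewrite /quadratic (bigD1 i)//= addrC; congr (_ + _).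
    by apply: eq_bigr => j /negPf ji; rewrite /A /B ji mul0r addr0.
  rewrite /A /B eqxx /a; field; exact/lt0r_neq0.
have Kf : forall y, Kp y -> f y <= 0.
  apply: (@max_principle R N Kp U f _ _ _ _ _ _ (pjet_sub_set (@subsetT _ U) fj)).
  - apply: compact_closedI; first exact: cube_compact.
    apply: (@closed_comp _ _ (fun y : E => y 0 i) [set t | x 0 i <= t]).
      by move=> y _; exact: coord_continuous.
    exact: closed_ge.
  - have -> : U = ball x r `&` [set y : E | x 0 i < y 0 i].
      apply/seteqP; split=> y [h1 h2]; split => //.
        by split => // k j; rewrite ord1 /ball/= distrC; exact: h1.
      by move=> j; rewrite distrC; exact: h1.2.
    apply: openI; first exact: ball_open.
    by apply: (@coord_open i [set t | x 0 i < t]); exact: open_gt.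
  - by move=> y [h1 h2]; split; [move=> j; exact/ltW|exact/ltW].
  - apply: continuous_subspaceT => y; apply: cts_addf.
      apply: cts_scalef; apply: cts_addf; first exact: wc.
      apply: cts_scalef; apply: continuous_comp; first exact: continuous_reflect.
      exact: wc.
    by apply: cts_scalef; exact: continuous_quadratic.
  - move=> y [h1 h2]; rewrite !big_split/= -!mulr_sumr big_split/= -!mulr_sumr.
    have -> : \sum_j A j = - (K / 2).
      rewrite (bigD1 i)//= (eq_bigr (fun=> a)); last by move=> j /negPf ji; rewrite /A ji.
      rewrite sumr_const cardC1 card_ord /A eqxx -[a *+ _]mulr_natl.
      have -> : N.-1%:R = N%:R - 1 :> R by rewrite -subn1 natrB// -(ler_nat R).
      ring.
    have cy : cube x r y by move=> j; exact/ltW.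
    have := HK _ cy; have := HK _ (cube_reflect i cy).
    rewrite !ltr_norml; lra.
  - move=> y [cy h1] nU; rewrite /f /phi quadE.
    set s := y 0 i - x 0 i.
    have s0 : 0 <= s by rewrite subr_ge0.
    have sr : s <= r by have := cy i; rewrite ler_norml => /andP[].
    have S0 : 0 <= \sum_(j | j != i) a * (y 0 j - x 0 j) ^+ 2.
      by apply: sumr_ge0 => j _; rewrite mulr_ge0// sqr_ge0.
    have T0 : 0 <= (N%:R - 1) * (s * (r - s)) by rewrite !mulr_ge0// subr_ge0.
    have T1 : 0 <= a * s * (N%:R * r - (N%:R - 1) * s).
      rewrite -mulrA mulr_ge0//.
      have -> : s * (N%:R * r - (N%:R - 1) * s) = s * r + (N%:R - 1) * (s * (r - s)) by ring.
      by rewrite addr_ge0// mulr_ge0// ltW.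
    have T2 : 0 <= K / 2 * s * (r - s) by rewrite !mulr_ge0// ?subr_ge0//; lra.
    have hM : a * r ^+ 2 = M by rewrite /a divfK// expf_neq0//; exact/lt0r_neq0.
    have w1 : 2^-1 * (w y + -1 * w (reflect i x y)) <= M.
      have := wM _ cy; have := wM _ (cube_reflect i cy).
      by rewrite !ler_norml; lra.
    (* On the hyperplane both sides vanish; on the opposite face, and on the
       lateral ones, the barrier is at least M. *)
    have [s_eq0|s_neq0] := eqVneq s 0.
      have -> : reflect i x y = y.
        apply/rowP => j; rewrite reflectE; case: eqVneq => [->|//].
        by move/eqP: s_eq0; rewrite subr_eq0 => /eqP ->; ring.
      lra.
    have [s_eqr|s_neqr] := eqVneq s r.
      have : a * s * (N%:R * r - (N%:R - 1) * s) = M.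
        by rewrite s_eqr -hM; ring.
      lra.
    suff : M <= \sum_(j | j != i) a * (y 0 j - x 0 j) ^+ 2 by lra.
    have [j jr] : exists j, ~~ (`|y 0 j - x 0 j| < r).
      apply: contrapT => /forallNP hn; apply: nU; split=> [j|].
        by apply: contrapT => /negP; exact: hn.
      by rewrite -subr_gt0 lt_neqAle eq_sym s_neq0.
    have ji : j != i.
      apply: contraNneq jr => ->; rewrite -/s ger0_norm// lt_neqAle sr.
      by rewrite s_neqr.
    rewrite (bigD1 j)//= -hM ler_wpDr//.
      by apply: sumr_ge0 => k _; rewrite mulr_ge0// sqr_ge0.
    rewrite ler_wpM2l// -[leRHS]real_normK ?num_real// ler_sqr ?nnegrE ?normr_ge0 ?(ltW r0)//.
    by rewrite leNgt.
have xx : reflect i x x = x.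
  by apply/rowP => j; rewrite reflectE; case: eqVneq => [->|//]; ring.
apply: (@is_derive_le_quadratic R (fun s : R => phi (x + s *: e_ i)) _ (A i) _ _ r0).
- by rewrite scale0r addr0 /phi xx; ring.
- apply: is_derive_line; rewrite scale0r addr0; apply: is_derive_eq.
    exact: (phij x I i).1.
  by rewrite eqxx xx; field.
- move=> s /andP[s0 sr].
  have : Kp (x + s *: e_ i).
    split=> [j|]; last by rewrite /= shift_coordE eqxx mul1r lerDl ltW.
    rewrite shift_coordE addrAC subrr add0r normrM (gtr0_norm s0).
    by case: (j == i); rewrite ?normr1 ?normr0 ?mul1r ?mul0r// ltW.
  move=> /Kf; rewrite /f.
  have -> : quadratic A B x (x + s *: e_ i) = A i * s ^+ 2 + B i * s.
    rewrite /quadratic (bigD1 i)//= shift_coordE eqxx mul1r (addrC (x 0 i)) addrK.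
    rewrite big1 ?addr0// => j /negPf ji.
    by rewrite shift_coordE ji mul0r addr0 subrr expr0n/= !mulr0 addr0.
  rewrite /B eqxx; lra.
Qed.

Lemma gradient_estimate (w : E -> R) D H (x : E) (r M K : R) i : 0 < r ->
  pjet setT w D H -> continuous w ->
  (forall y, cube x r y -> `|w y| <= M) ->
  (forall y, cube x r y -> `|\sum_j H j y| < K) ->
  `|D i x| <= N%:R * M / r + r * K / 2.
Proof.
move=> r0 wj wc wM HK; rewrite ler_norml; apply/andP; split; last first.
  exact: gradient_estimate_le wM HK.
rewrite lerNl -mulN1r.
apply: (@gradient_estimate_le (fun y => -1 * w y) (fun j y => -1 * D j y) _ x
  r M K i r0 (pjet_scale (-1) wj)).
- by move=> y; apply: cts_scalef; exact: wc.
- by move=> y /wM; rewrite mulN1r normrN.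
- by move=> y /HK; rewrite -mulr_sumr mulN1r normrN.
Qed.

End GradientEstimate.

(** * Product bump functions with all their derivatives *)

Section DerivativeFromRemainder.
Context {R : realType} {V : normedModType R}.

Lemma is_derive_little (f : V -> R) (x v : V) (l : R) :
  (forall t, 0 < t -> exists2 r : R, 0 < r & forall h, `|h| < r ->
     `|f (x + h *: v) - f x - h * l| <= t * `|h|) ->
  is_derive x v f l.
Proof.
move=> hf.
have hl : (fun h : R => h^-1 *: ((f \o shift x) (h *: v) - f x)) @ 0^' --> l.
  apply/cvgrPdist_le => t t0; have [r r0 hr] := hf t t0; near=> h.
  have h0 : h != 0 by near: h; exact: nbhs_dnbhs_neq.
  have hhr : `|h| < r by near: h; apply: dnbhs0_lt.
  rewrite /= addrC [h *: v + x]addrC.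
  have -> : h^-1 *: (f (x + h *: v) - f x) = l + h^-1 * (f (x + h *: v) - f x - h * l).
    by rewrite /GRing.scale/=; field.
  set X := h^-1 * _.
  have -> : - (l + X) + l = - X by ring.
  by rewrite normrN normrM normfV mulrC ler_pdivrMr ?normr_gt0//; exact: hr.
apply: DeriveDef; first by apply/cvg_ex; exists l.
exact: (@cvg_lim _ (@norm_hausdorff _ R)).
Unshelve. all: end_near. Qed.

Lemma is_derive_quadratic_remainder (f : V -> R) (x v : V) (l C r : R) : 0 < r ->
  (forall h, `|h| < r -> `|f (x + h *: v) - f x - h * l| <= C * h ^+ 2) ->
  is_derive x v f l.
Proof.
move=> r0 hf; apply: is_derive_little => t t0.
have C0 : 0 < `|C| + 1 by rewrite ltr_wpDl.
exists (Num.min r (t / (`|C| + 1))) => [|h]; first by rewrite lt_min r0 divr_gt0.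
rewrite lt_min => /andP[hr]; rewrite ltr_pdivlMr// => ht.
apply: (le_trans (hf _ hr)); rewrite -real_normK ?num_real// expr2 mulrA ler_wpM2r//.
apply: le_trans (ltW ht); rewrite mulrC ler_wpM2l//.
by rewrite (le_trans (ler_norm C))// lerDl.
Qed.

End DerivativeFromRemainder.

Section Bump.
Context {R : realType}.
Implicit Types (p q : {poly R}) (t s e : R).

(** The functions p(1/t) exp(-1/t), extended by zero: a class stable under
differentiation that contains exp(-1/t). *)
Definition flat p t : R := if 0 < t then p.[t^-1] * expR (- t^-1) else 0.

Definition flat_next p : {poly R} := 'X^2 * (p - p^`()).

Lemma flat_pos_derive p t : 0 < t ->
  is_derive t (1 : R) (flat p) (flat (flat_next p) t).
Proof.
move=> t0; apply: (@near_eq_is_derive R _ _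
   ((fun s : R => p.[s] * expR (- s)) \o (fun u : R => u^-1)) (flat p)).
  near=> u; rewrite /flat /= ifT//.
  near: u; exact: lt_nbhsr.
have -> : flat (flat_next p) t =
  ((p.[t^-1] * (expR (- t^-1) * -1) + expR (- t^-1) * p^`().[t^-1]) * (- t ^- 2)).
  rewrite /flat t0 /flat_next !hornerE -exprVn /=; ring.
apply: is_derive1_comp.
  exact: (is_derive_mulf (is_derive_poly p _)
    (@is_derive1_comp R expR (fun s => - s) _ _ _ (is_derive_expR _) (is_deriveNid _ _))).
have := @is_deriveV R id t 1 1 (lt0r_neq0 t0) (is_derive_id _ _).
by move=> /is_derive_eq; apply; rewrite /GRing.scale/= mulr1.
Unshelve. all: end_near. Qed.

(** The exponential beats every polynomial; a bound of order t^2 is what makes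
the derivative at 0 exist and vanish. *)
Lemma flat_small p : exists C, forall t, `|t| < 1 -> `|flat p t| <= C * t ^+ 2.
Proof.
pose P := \sum_(i < size p) `|p`_i|.
have P0 : 0 <= P by apply: sumr_ge0.
pose n := size p.
exists (P * (n.+2)`!%:R) => t t1; rewrite /flat.
case: ifPn => [t0|_]; last by rewrite normr0 mulr_ge0 ?sqr_ge0// mulr_ge0.
set s := t^-1.
have s0 : 0 < s by rewrite invr_gt0.
have s1 : 1 <= s by rewrite invf_ge1// ltW// (le_lt_trans (ler_norm t)).
have hp : `|p.[s]| <= P * s ^+ n.
  rewrite horner_coef (le_trans (ler_norm_sum _ _ _))// mulr_suml ler_sum// => i _.
  rewrite normrM ler_wpM2l// normrX gtr0_norm// ler_weXn2l//.
  exact/ltnW/ltn_ord.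
have he : expR (- s) <= (n.+2)`!%:R / s ^+ n.+2.
  rewrite expRN invf_ple ?posrE ?expR_gt0//; last first.
    by rewrite divr_gt0 ?exprn_gt0// ltr0n fact_gt0.
  have := @expR_ge1Dxn R s n.+1 (ltW s0).
  by rewrite invfM invrK mulrC; lra.
rewrite normrM (gtr0_norm (expR_gt0 _)).
apply: (le_trans (ler_pM (normr_ge0 _) (expR_ge0 _) hp he)).
rewrite le_eqVlt; apply/orP; left; apply/eqP.
have -> : t = s^-1 by rewrite invrK.
have -> : s ^+ n.+2 = s ^+ n * s ^+ 2 by rewrite -exprD addn2.
have sn0 : s ^+ n != 0 by rewrite expf_neq0// lt0r_neq0.
have alg (a b c d : R) : c != 0 -> d != 0 ->
    a * c * (b / (c * d ^+ 2)) = a * b * d^-1 ^+ 2.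
  by move=> c0 d0; field; rewrite c0 d0.
exact: alg (lt0r_neq0 s0).
Qed.

Lemma flat_derive p t : is_derive t (1 : R) (flat p) (flat (flat_next p) t).
Proof.
have [t0|t0|<-] := ltgtP 0 t; first exact: flat_pos_derive.
- have -> : flat (flat_next p) t = 0 by rewrite /flat ltNge (ltW t0).
  apply: (@near_eq_is_derive R _ _ (cst 0 : R -> R)).
  near=> u; rewrite /flat /= ifF//; apply/negbTE; rewrite -leNgt ltW//.
  near: u; exact: lt_nbhsl.
- have [C hC] := flat_small p.
  apply: (@is_derive_quadratic_remainder _ _ _ _ _ _ C 1) => // h h1.
  have f0 q : flat q 0 = 0 by rewrite /flat ltxx.
  rewrite !f0 mulr0 !subr0 add0r [h *: 1]mulr1; exact: hC.
Unshelve. all: end_near. Qed.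

Lemma flat_nonpos p t : t <= 0 -> flat p t = 0.
Proof. by move=> t0; rewrite /flat ltNge t0. Qed.

(** The product of exp(-1/(e+t)) and exp(-1/(e-t)).  The whole sequence of
derivatives is produced at once, F k being the k-th one, so that smoothness of
products never requires iterating an abstract derivative operator. *)
Lemma bump_exists e : 0 < e -> exists F : nat -> R -> R,
  [/\ forall k t, is_derive t (1 : R) (F k) (F k.+1 t),
      forall k t, e <= `|t| -> F k t = 0,
      forall t, 0 <= F 0%N t &
      forall t, `|t| < e -> 0 < F 0%N t].
Proof.
move=> e0.
pose G a := flat (iter a flat_next 1).
have Gd a t : is_derive t (1 : R) (G a) (G a.+1 t) by exact: flat_derive.
(* T k a b is the k-th derivative of the product of the a-th derivative of
   one factor and the b-th derivative of the other, by the Leibniz rule. *)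
pose T := fix T k a b t := if k is k'.+1 then T k' a.+1 b t - T k' a b.+1 t
  else G a (e + t) * G b (e - t).
have Td k : forall a b t, is_derive t (1 : R) (T k a b) (T k.+1 a b t).
  elim: k => [|k IH] a b t.
    have ha : is_derive t (1 : R) (fun t => G a (e + t)) (G a.+1 (e + t)).
      have h : is_derive t (1 : R) (fun t : R => e + t) 1.
        by apply: (is_derive_eq (is_derive_addf (is_derive_cst e _ _) (is_derive_id _ _))); rewrite add0r.
      by apply: (is_derive_eq (is_derive1_comp (Gd a (e + t)) h)); rewrite mulr1.
    have hb : is_derive t (1 : R) (fun t => G b (e - t)) (- G b.+1 (e - t)).
      have h : is_derive t (1 : R) (fun t : R => e - t) (-1).
        by apply: (is_derive_eq (is_derive_addf (is_derive_cst e _ _) (is_deriveNid _ _))); rewrite add0r.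
      by apply: (is_derive_eq (@is_derive1_comp R (G b) (fun t => e - t) t _ _ (Gd b (e - t)) h)); rewrite mulrN1.
    by apply: (is_derive_eq (is_derive_mulf ha hb)) => /=; ring.
  exact: is_deriveB (IH _ _ _) (IH _ _ _).
have T0 k : forall a b t, e <= `|t| -> T k a b t = 0.
  elim: k => [|k IH] a b t te /=; last by rewrite !IH// subrr.
  have [t0|t0] := leP 0 t.
    by rewrite /G (@flat_nonpos _ (e - t)) ?mulr0// subr_le0; rewrite ger0_norm in te.
  rewrite /G (@flat_nonpos _ (e + t)) ?mul0r//; rewrite ltr0_norm// in te; lra.
have G0 t : 0 <= G 0%N t.
  by rewrite /G /flat; case: ifP => // _; rewrite /= hornerC mul1r expR_ge0.
exists (fun k => T k 0%N 0%N); split => //.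
- by move=> k t te; exact: T0.
- by move=> t; rewrite mulr_ge0.
- move=> t; rewrite ltr_norml => te /=.
  by rewrite /G /flat !ifT ?hornerC ?mul1r ?mulr_gt0 ?expR_gt0//; lra.
Qed.

End Bump.

Section TensorProducts.
Context {R : realType} {N : nat}.
Local Notation E := 'rV[R]_N.
Local Notation e_ i := (delta_mx (0 : 'I_1) i : E).
Implicit Types (phi : 'I_N -> nat -> R -> R) (k : 'I_N -> nat) (i j : 'I_N).

(** The partial derivative of multi-index k of the product of the functions
phi j 0 of the separate coordinates. *)
Definition tens phi k (y : E) : R := \prod_j phi j (k j) (y 0 j).

Definition incr k i : 'I_N -> nat := fun j => ((j == i) + k j)%N.

Lemma is_derive_tens phi k i y :
  (forall j m t, is_derive t (1 : R) (phi j m) (phi j m.+1 t)) ->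
  is_derive y (e_ i) (tens phi k) (tens phi (incr k i) y).
Proof.
move=> phid; apply: is_derive_lineP.
have -> : (fun s : R => tens phi k (y + s *: e_ i)) =
   (fun s => (\prod_(j | j != i) phi j (k j) (y 0 j)) * phi i (k i) (y 0 i + s)).
  apply/funext => s; rewrite /tens (bigD1 i)//= mulrC shift_coordE eqxx mul1r; congr (_ * _).
  by apply: eq_bigr => j /negPf ji; rewrite shift_coordE ji mul0r addr0.
have -> : tens phi (incr k i) y =
  (\prod_(j | j != i) phi j (k j) (y 0 j)) * phi i (k i).+1 (y 0 i).
  rewrite /tens (bigD1 i)//= mulrC /incr eqxx; congr (_ * _).
  by apply: eq_bigr => j /negPf ->.
apply: is_derive_scalef.
have h : is_derive (0 : R) (1 : R) (fun s : R => y 0 i + s) 1.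
  by apply: (is_derive_eq (is_derive_addf (is_derive_cst (y 0 i) _ _) (is_derive_id _ _))); rewrite add0r.
have hp : is_derive (y 0 i + 0) (1 : R) (phi i (k i)) (phi i (k i).+1 (y 0 i)).
  by rewrite addr0; exact: phid.
by apply: (is_derive_eq (@is_derive1_comp R _ (fun s => y 0 i + s) _ _ _ hp h)); rewrite mulr1.
Qed.

Lemma continuous_tens phi k :
  (forall j m t, is_derive t (1 : R) (phi j m) (phi j m.+1 t)) ->
  continuous (tens phi k).
Proof.
move=> phid y.
rewrite (_ : tens phi k = \prod_j (fun y : E => phi j (k j) (y 0 j))); last first.
  by apply/funext => z; rewrite fct_prodE.
apply: (big_ind (fun f : E -> R => {for y, continuous f})).
- exact: (@cts_cstf R E R 1).
- by move=> g h gc hc; exact: cts_mulf.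
move=> j _; apply: (@continuous_comp _ _ _ (fun y : E => y 0 j)); first exact: cts_coord.
exact: (@is_derive_continuous _ _ (phi j (k j).+1)).
Qed.

Lemma partials_tens phi k (s : seq 'I_N) :
  (forall j m t, is_derive t (1 : R) (phi j m) (phi j m.+1 t)) ->
  exists k', partials s (tens phi k) = tens phi k'.
Proof.
move=> phid; elim: s => [|i s [k' IH]]; first by exists k.
exists (incr k' i); rewrite /= IH; apply/funext => y.
have h := @is_derive_tens phi k' i y phid.
by rewrite /partial derive_val.
Qed.

Lemma smooth_tens phi k :
  (forall j m t, is_derive t (1 : R) (phi j m) (phi j m.+1 t)) ->
  smooth_on setT (tens phi k).
Proof.
move=> phid n s x _; have [k' ->] := partials_tens k s phid.
split=> [_|_ i]; first exact: continuous_tens.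
by have [] := @is_derive_tens phi k' i x phid.
Qed.

Lemma laplacian_tens phi k y :
  (forall j m t, is_derive t (1 : R) (phi j m) (phi j m.+1 t)) ->
  laplacian (tens phi k) y = \sum_i tens phi (incr (incr k i) i) y.
Proof.
move=> phid; rewrite /laplacian; apply: eq_bigr => i _.
have -> : partial i (tens phi k) = tens phi (incr k i).
  apply/funext => z; have h := @is_derive_tens phi k i z phid.
  by rewrite /partial derive_val.
have h := @is_derive_tens phi (incr k i) i y phid.
by rewrite /partial derive_val.
Qed.

End TensorProducts.

Section MollifierKernel.
Context {R : realType} {N : nat}.
Local Notation E := 'rV[R]_N.
Local Notation e_ i := (delta_mx (0 : 'I_1) i : E).
Variables (F : nat -> R -> R) (e : R).
Hypothesis Fd : forall k t, is_derive t (1 : R) (F k) (F k.+1 t).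
Hypothesis Fsupp : forall k t, e <= `|t| -> F k t = 0.
Implicit Types (k : 'I_N -> nat) (i j : 'I_N) (x y z : E).

Definition kern k : E -> R := tens (fun=> F) k.

Lemma is_derive_bump_shift m c t :
  is_derive t (1 : R) (fun s => F m (s - c)) (F m.+1 (t - c)).
Proof.
have h : is_derive t (1 : R) (fun s : R => s - c) 1.
  apply: (is_derive_eq (is_derive_addf (is_derive_id _ _) (is_derive_cst (- c) _ _))).
  by rewrite addr0.
apply: (is_derive_eq (@is_derive1_comp R (F m) (fun s => s - c) t _ _ (Fd _ _) h)).
by rewrite mulr1.
Qed.

Lemma bump_bounded m : exists2 B, 0 <= B & forall t, `|F m t| <= B.
Proof.
have : compact `[- e, e] by exact: segment_compact.
move=> ce; have Fc : {within `[- e, e], continuous F m}.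
  by apply: continuous_subspaceT => t; exact: (@is_derive_continuous _ _ (F m.+1)).
have [B [_ hB]] := compact_bounded (continuous_compact Fc ce).
exists (`|B| + 1) => [|t]; first by rewrite addr_ge0.
have [te|te] := leP e `|t|.
  by rewrite Fsupp// normr0 addr_ge0.
apply: hB; first by rewrite (le_lt_trans (ler_norm B))// ltrDl.
by exists t => //=; rewrite in_itv/= -ler_norml ltW.
Qed.

Lemma kern_bounded k : exists2 B, 0 <= B & forall z, `|kern k z| <= B.
Proof.
have /choice[B hB] : forall m, exists B, 0 <= B /\ forall t, `|F m t| <= B.
  by move=> m; have [B B0 hB] := bump_bounded m; exists B.
exists (\prod_j B (k j)); first by apply: prodr_ge0 => j _; exact: (hB _).1.
move=> z; rewrite /kern /tens normr_prod; apply: ler_prod => j _.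
by rewrite normr_ge0 (hB _).2.
Qed.

Lemma kern_supp k z : ~ cube 0 e z -> kern k z = 0.
Proof.
move=> nz; have [j hj] : exists j, ~ `|z 0 j - (0 : E) 0 j| <= e.
  by apply: contrapT => /forallNP h; apply: nz => j; apply: contrapT; exact: h.
rewrite /kern /tens (bigD1 j)//= Fsupp ?mul0r//.
by move: hj => /negP; rewrite mxE subr0 -ltNge => /ltW.
Qed.

Lemma continuous_kern k : continuous (kern k).
Proof. exact: continuous_tens. Qed.

Lemma taylor1_bound (g dg ddg : R -> R) (B h : R) :
  (forall t, is_derive t (1 : R) g (dg t)) ->
  (forall t, is_derive t (1 : R) dg (ddg t)) ->
  (forall t, `|ddg t| <= B) ->
  `|g h - g 0 - h * dg 0| <= B * h ^+ 2.
Proof.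
move=> gd dgd hB.
have B0 : 0 <= B by apply: le_trans (hB 0).
have H := @mvt_bound R g dg (dg 0) (B * `|h|) 0 h (fun t _ => gd t).
rewrite subr0 in H; rewrite (mulrC h) -real_normK ?num_real// expr2 mulrA.
apply: H => t /andP[t1 t2].
have := @mvt_bound R dg ddg 0 B 0 t (fun t _ => dgd t).
rewrite mul0r !subr0 => H.
apply: (le_trans (H _)) => [u _|]; first by rewrite subr0.
rewrite ler_wpM2l//.
move: t1 t2; rewrite ge_min le_max !ler_norml.
have := ler_norm h; have := ler_norm (- h); rewrite normrN.
have := normr_ge0 h.
by move=> a b c /orP[] ? /orP[] ?; lra.
Qed.

(** The remainder is bounded uniformly in z, which is what allows
differentiation under the integral sign in a mollification. *)
Lemma kern_taylor k i : exists2 B, 0 <= B & forall z h,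
  `|kern k (z - h *: e_ i) - kern k z - h * - kern (incr k i) z| <= B * h ^+ 2.
Proof.
have [B B0 hB] := kern_bounded (incr (incr k i) i).
exists B => // z h.
have hl m t : is_derive t (1 : R) (fun t => kern m (z - t *: e_ i)) (- kern (incr m i) (z - t *: e_ i)).
  have hN : is_derive t (1 : R) (fun t : R => - t) (-1) by exact: is_deriveNid.
  have hL : is_derive (- t) (1 : R) (fun t => kern m (z + t *: e_ i)) (kern (incr m i) (z - t *: e_ i)).
    by apply: is_derive_line; rewrite scaleNr; exact: is_derive_tens.
  have := is_derive1_comp hL hN.
  rewrite mulrN1 (_ : (_ \o _) = (fun t => kern m (z - t *: e_ i)))//.
  by apply/funext => u /=; rewrite scaleNr.
have := @taylor1_bound (fun t => kern k (z - t *: e_ i)) (fun t => - kern (incr k i) (z - t *: e_ i))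
  (fun t => - - kern (incr (incr k i) i) (z - t *: e_ i)) B h (hl k).
rewrite scale0r subr0; apply.
by move=> t; rewrite opprK.
Qed.

Lemma test_function_kern (Omega : set E) k x : cube x e `<=` Omega ->
  test_function Omega (fun y => kern k (y - x)).
Proof.
move=> hx.
have -> : (fun y => kern k (y - x)) = tens (fun j m t => F m (t - x 0 j)) k.
  by apply/funext => y; apply: eq_bigr => j _; rewrite !mxE.
split.
  by apply: smooth_tens => j m t; exact: is_derive_bump_shift.
exists (cube x e); split => //; first exact: cube_compact.
move=> y ny; have <- : kern k (y - x) = tens (fun j m t => F m (t - x 0 j)) k y.
  by apply: eq_bigr => j _; rewrite !mxE.
apply: kern_supp => h; apply: ny => j; have := h j.
by rewrite !mxE subr0.
Qed.

Lemma laplacian_kern k x y :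
  laplacian (fun y => kern k (y - x)) y = \sum_i kern (incr (incr k i) i) (y - x).
Proof.
have h m : (fun y => kern m (y - x)) = tens (fun j m t => F m (t - x 0 j)) m.
  by apply/funext => z; apply: eq_bigr => j _; rewrite !mxE.
rewrite h (laplacian_tens k y (fun j m t => is_derive_bump_shift m (x 0 j) t)).
by apply: eq_bigr => i _; rewrite -h.
Qed.

End MollifierKernel.

(** * Integration against Lebesgue measure *)

Section LebesgueProduct.
Context {R : realType}.
Local Notation mu := (@lebesgue_measure R).
Local Notation tupR n := (n.-tuple (measurableTypeR R)).

Lemma measurable_prod_coord n (g : 'I_n -> R -> R) :
  (forall i, measurable_fun setT (g i)) ->
  measurable_fun setT (fun t : tupR n => \prod_i g i (tnth t i)).
Proof.
move=> mg; apply: (@measurable_prod _ _ R setT 'I_n (index_enum 'I_n) (fun i (t : tupR n) => g i (tnth t i))) => i _.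
by apply: measurableT_comp; [exact: mg|exact: measurable_tnth].
Qed.

(** By induction on n with Tonelli, the measure on R^(n+1) being the image of a
product measure. *)
Lemma integral_tensor n (g : 'I_n -> R -> R) :
  (forall i, measurable_fun setT (g i)) -> (forall i t, 0 <= g i t) ->
  (\int[@lebesgueN R n]_t (\prod_i g i (tnth t i))%:E =
   \prod_i \int[mu]_s (g i s)%:E)%E.
Proof.
elim: n g => [|n IH] g mg g0.
  rewrite big_ord0; under eq_integral do rewrite big_ord0.
  by rewrite /= integral_dirac//= diracT mul1e.
have mP := measurable_prod_coord mg.
rewrite /= (_ : (\int[_]_t _)%E =
    (\int[(mu \x lebesgueN R n)%E]_p (\prod_i g i (tnth (consT p) i))%:E)%E); last first.
  apply: etrans.
    apply: (@ge0_integral_pushforward _ _ _ _ R (@consT R n) (@measurable_consT R n)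
      (mu \x lebesgueN R n)%E setT).
    - exact: measurableT.
    - exact/measurable_EFinP.
    - by move=> t _; rewrite lee_fin prodr_ge0.
  by rewrite preimage_setT.
rewrite fubini_tonelli1 //=; last 2 first.
- apply/measurable_EFinP; apply: (measurableT_comp mP); exact: measurable_consT.
- by move=> p; rewrite lee_fin prodr_ge0.
have step (s : R) : (\int[lebesgueN R n]_t (\prod_i g i (tnth (consT (s, t)) i))%:E =
    (g ord0 s)%:E * \prod_i \int[mu]_s (g (lift ord0 i) s)%:E)%E.
  rewrite -(IH (fun i => g (lift ord0 i)))// -ge0_integralZl//; last 3 first.
  - by apply/measurable_EFinP; apply: (@measurable_prod_coord n (fun i => g (lift ord0 i))).
  - by move=> t _; rewrite lee_fin prodr_ge0.
  - by rewrite lee_fin.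
  apply: eq_integral => t _; rewrite -EFinM big_ord_recl tnth0; congr (_ * _)%:E.
  by apply: eq_bigr => i _; rewrite tnthS.
transitivity (\int[mu]_s ((g ord0 s)%:E * \prod_i \int[mu]_s (g (lift ord0 i) s)%:E))%E.
  by apply: eq_integral => s _; exact: step.
rewrite [RHS]big_ord_recl.
rewrite ge0_integralZr//.
- by apply/measurable_EFinP; exact: mg.
- by move=> s _; rewrite lee_fin.
- apply: (big_ind (fun x => 0 <= x)%E) => //; first by move=> a b; exact: mule_ge0.
  by move=> i _; apply: integral_ge0 => s _; rewrite lee_fin.
Qed.

Lemma lebesgue_translation (G : R -> R) (c : R) : continuous G -> (forall x, 0 <= G x) ->
  (\int[mu]_x (G x)%:E = \int[mu]_x (G (x - c))%:E)%E.
Proof.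
move=> Gc G0.
pose F (x : R) := x - c.
have Fd x : is_derive x (1 : R) F 1.
  by apply: (is_derive_eq (is_derive_addf (is_derive_id _ _) (is_derive_cst (- c) _ _))); rewrite addr0.
have F' : derive1 F = cst 1 by apply/funext => x; rewrite derive1E derive_val.
rewrite (@increasing_ge0_integration_by_substitutionT R F G)//.
- by apply: eq_integral => x _; rewrite F' /= mulr1.
- by move=> x y; rewrite /F ltrD2r.
- by rewrite F'; exact: cst_continuous.
- by rewrite F'; exact: is_cvg_cst.
- by rewrite F'; exact: is_cvg_cst.
- apply/cvgrNyPle => A; near=> x; rewrite /F lerBlDr.
  by near: x; apply: nbhs_ninfty_le; exact: num_real.
- apply/cvgryPge => A; near=> x; rewrite /F lerBrDr.
  by near: x; apply: nbhs_pinfty_ge; exact: num_real.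
Unshelve. all: end_near. Qed.

End LebesgueProduct.

Section MeasureRN.
Context {R : realType} {N : nat}.
Local Notation E := 'rV[R]_N.
Local Notation mu := (@lebesgueN R N).
Local Notation integral_over := (@Defs.integralN R N).
Local Notation tupR := (N.-tuple (measurableTypeR R)).
Implicit Types (U Omega : set E) (x y : E).

Lemma measurable_boxT (A : 'I_N -> set (measurableTypeR R)) :
  (forall i, measurable (A i)) -> measurable [set t : tupR | forall i, A i (tnth t i)].
Proof.
move=> mA.
rewrite (_ : [set t | _] = \bigcap_(i in [set: 'I_N]) ((@tnth N _)^~ i @^-1` A i)); last first.
  by apply/seteqP; split => [t tA i _|t tA i]; exact: tA.
apply: fin_bigcap_measurable => // i _; rewrite -[X in measurable X]setTI.
exact: measurable_tnth.
Qed.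

Lemma cube_boxT x (r : R) : (@rowT R N) @^-1` cube x r =
  [set t : tupR | forall i, `[x 0 i - r, x 0 i + r]%classic (tnth t i)].
Proof.
by apply/seteqP; split=> t h i; have := h i; rewrite /= mxE in_itv/= ler_norml; lra.
Qed.

Lemma measurable_cubeT x (r : R) : measurable ((@rowT R N) @^-1` cube x r).
Proof.
rewrite cube_boxT.
exact: (@measurable_boxT (fun i => `[x 0 i - r, x 0 i + r]%classic) (fun i => measurable_itv _)).
Qed.

(** An open set is the union of the cubes with rational centre and half side
1/(k+1) that it contains, and there are countably many of these. *)
Lemma measurable_openT U : open U -> measurable ((@rowT R N) @^-1` U).
Proof.
move=> oU.
pose C (q : 'rV[rat]_N * nat) : set E := cube (map_mx ratr q.1) (q.2.+1%:R^-1).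
pose J := [set q | C q `<=` U].
have -> : U = \bigcup_(q in J) C q.
  apply/seteqP; split=> [x Ux|x [q Jq]]; last exact: Jq.
  have [r r0 hr] := nbhs_cubeP (open_nbhs_nbhs (conj oU Ux)).
  have [k hk] : exists k : nat, k.+1%:R^-1 < r / 2.
    have r2 : 0 < r / 2 by lra.
    have := near_infty_natSinv_lt (PosNum r2) => -[k _ hk].
    by exists k; exact: (hk k (leqnn k)).
  pose d : R := k.+1%:R^-1.
  have d0 : 0 < d by rewrite invr_gt0 ltr0n.
  have /choice[q hq] : forall i : 'I_N, exists q : rat, `|x 0 i - ratr q| <= d.
    move=> i; have h : x 0 i - d < x 0 i + d by lra.
    have [q] := rat_in_itvoo h; rewrite in_itv/= => /andP[? ?].
    by exists q; rewrite ler_norml; lra.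
  have hx : C (\row_i q i, k) x by move=> i; rewrite !mxE; exact: hq.
  exists (\row_i q i, k) => //; rewrite /J/= => y Cy; apply: hr.
  apply: (cubeW (r := d + d)); first by have dr : d < r / 2 := hk; lra.
  exact: (cube_trans (cube_sym hx) Cy).
rewrite preimage_bigcup bigcup_mkcond; apply: countable_bigcupT_measurable => // q.
by case: ifP => // _; exact: measurable_cubeT.
Qed.

Lemma lebesgueN_cube x (r : R) : 0 < r -> mu ((@rowT R N) @^-1` cube x r) = ((2 * r) ^+ N)%:E.
Proof.
move=> r0; rewrite cube_boxT.
rewrite (@lebesgueN_box R N (fun i => `[x 0 i - r, x 0 i + r]%classic)); last first.
  by move=> i; exact: measurable_itv.
rewrite (eq_bigr (fun=> (2 * r)%:E)); last first.
  move=> i _; rewrite lebesgue_measure_itv/= lte_fin ifT; last lra.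
  by rewrite -EFinD; congr EFin; ring.
have h (a : R) n : iter n (mule a%:E) 1%E = (a ^+ n)%:E.
  by elim: n => [|n IH] //=; rewrite IH -EFinM -exprS.
by rewrite big_const_ord h.
Qed.

Lemma bounded_sub_cube (A : set E) : bounded_set A -> exists2 M : R, 0 < M & A `<=` cube 0 M.
Proof.
move=> /ex_strict_bound_gt0[M M0 hM]; exists M => // y /hM /= yM j.
have : ball (0 : E) M y by rewrite -ball_normE /ball_/= sub0r normrN.
by case=> _ /(_ 0 j); rewrite /ball/= distrC => /ltW.
Qed.

Section DomainIntegral.
Variable Omega : set E.
Hypothesis oOmega : open Omega.
Hypothesis bOmega : bounded_set Omega.
Local Notation D := ((@rowT R N) @^-1` Omega).

Lemma finite_domain : (mu D < +oo)%E.
Proof.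
have [M M0 hM] := bounded_sub_cube bOmega.
apply: (@le_lt_trans _ _ (mu ((@rowT R N) @^-1` cube 0 M))).
  apply: le_measure; rewrite ?inE; [exact: measurable_openT|exact: measurable_cubeT|].
  by move=> t; exact: hM.
by rewrite lebesgueN_cube// ltry.
Qed.

(** The class of functions on which the integral over Omega is finite and
linear; every integrand below belongs to it. *)
Definition bdd_continuous_on (g : E -> R) : Prop :=
  (forall x, Omega x -> {for x, continuous g}) /\
  exists C, forall x, Omega x -> `|g x| <= C.

Lemma measurable_fun_open (g : E -> R) : (forall x, Omega x -> {for x, continuous g}) ->
  measurable_fun D (g \o (@rowT R N)).
Proof.
move=> gc; apply: (measurability _ (RGenOpens.measurableE R)).
move=> _ [_ [a [b ->] <-]].
rewrite (_ : _ `&` _ = (@rowT R N) @^-1` (Omega `&` g @^-1` `]a, b[%classic)); last by [].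
apply: measurable_openT; rewrite openE => x [Ox gx]; rewrite /interior.
apply: filterI; first exact: open_nbhs_nbhs.
by apply: (gc x Ox); apply: open_nbhs_nbhs; split => //; exact: interval_open.
Qed.

Lemma bdd_continuous_integrable (g : E -> R) : bdd_continuous_on g ->
  mu.-integrable D (EFin \o (g \o (@rowT R N))).
Proof.
move=> [gc [C gC]]; apply: measurable_bounded_integrable.
- exact: measurable_openT.
- exact: finite_domain.
- exact: measurable_fun_open.
- exists C; split; first exact: num_real.
  by move=> M CM t /gC gt; apply: (le_trans gt); exact: ltW.
Qed.

Lemma bdd_continuous_add g h : bdd_continuous_on g -> bdd_continuous_on h -> bdd_continuous_on (fun x => g x + h x).
Proof.
move=> [gc [C gC]] [hc [C' hC]]; split=> [x Ox|].
  by apply: cts_addf; [exact: gc|exact: hc].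
exists (C + C') => x Ox; rewrite (le_trans (ler_normD _ _))// lerD//; [exact: gC|exact: hC].
Qed.

Lemma bdd_continuous_scale c g : bdd_continuous_on g -> bdd_continuous_on (fun x => c * g x).
Proof.
move=> [gc [C gC]]; split=> [x Ox|]; first by apply: cts_scalef; exact: gc.
by exists (`|c| * C) => x Ox; rewrite normrM ler_wpM2l//; exact: gC.
Qed.

Lemma bdd_continuous_mul g h : bdd_continuous_on g -> bdd_continuous_on h -> bdd_continuous_on (fun x => g x * h x).
Proof.
move=> [gc [C gC]] [hc [C' hC]]; split=> [x Ox|].
  by apply: cts_mulf; [exact: gc|exact: hc].
by exists (C * C') => x Ox; rewrite normrM ler_pM//; [exact: gC|exact: hC].
Qed.

Lemma integralN_add g h : bdd_continuous_on g -> bdd_continuous_on h ->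
  integral_over Omega (fun x => g x + h x) = integral_over Omega g + integral_over Omega h.
Proof.
move=> gr hr; rewrite /Defs.integralN RintegralD//.
- exact: measurable_openT.
- exact: bdd_continuous_integrable.
- exact: bdd_continuous_integrable.
Qed.

Lemma integralN_scale c g : bdd_continuous_on g ->
  integral_over Omega (fun x => c * g x) = c * integral_over Omega g.
Proof.
move=> gr; rewrite /Defs.integralN RintegralZl//.
- exact: measurable_openT.
- exact: bdd_continuous_integrable.
Qed.

Lemma integralN_le g h : bdd_continuous_on g -> bdd_continuous_on h ->
  (forall x, Omega x -> g x <= h x) -> integral_over Omega g <= integral_over Omega h.
Proof.
move=> gr hr gh; rewrite /Defs.integralN; apply: le_Rintegral.
- exact: measurable_openT.
- exact: bdd_continuous_integrable.
- exact: bdd_continuous_integrable.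
- by move=> t; exact: gh.
Qed.

Lemma eq_integralN g h : (forall x, Omega x -> g x = h x) ->
  integral_over Omega g = integral_over Omega h.
Proof. by move=> gh; apply: eq_Rintegral => t; rewrite inE; exact: gh. Qed.

Definition volume : R := fine (mu D).

Lemma integralN_norm_le g C : bdd_continuous_on g -> (forall x, Omega x -> `|g x| <= C) ->
  `|integral_over Omega g| <= C * volume.
Proof.
move=> gr gC.
have cr c : bdd_continuous_on (fun=> c).
  by split=> [x _|]; [exact: cts_cstf|exists `|c|].
have hc c : integral_over Omega (fun=> c) = c * volume.
  by rewrite /Defs.integralN Rintegral_cst//; exact: measurable_openT.
rewrite ler_norml -mulNr -!hc; apply/andP; split; apply: integralN_le => // x Ox.
  by have := gC _ Ox; rewrite ler_norml => /andP[].
by have := gC _ Ox; rewrite ler_norml => /andP[].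
Qed.

End DomainIntegral.

(** If the inequality failed at a point, it would fail on a whole cube about
it, and cubes have positive measure. *)
Lemma ae_in_everywhere Omega (f g : E -> R) : open Omega ->
  (forall x, Omega x -> {for x, continuous f}) ->
  (forall x, Omega x -> {for x, continuous g}) ->
  ae_in Omega (fun x => f x <= g x) -> forall x, Omega x -> f x <= g x.
Proof.
move=> oO fc gc [A [mA A0 sA]] x Ox; rewrite leNgt; apply/negP => gf.
have : \forall y \near x, Omega y /\ g y < f y.
  have h : {for x, continuous (fun y => f y + (-1) * g y)}.
    by apply: cts_addf; [exact: fc|apply: cts_scalef; exact: gc].
  have h2 : nbhs x ((fun y => f y + (-1) * g y) @^-1` [set s | 0 < s]).
    by apply: h; apply: open_nbhs_nbhs; split; [exact: open_gt|rewrite /= mulN1r subr_gt0].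
  near=> y; split; first by near: y; exact: open_nbhs_nbhs.
  rewrite -subr_gt0 -mulN1r; near: y; exact: h2.
move=> /nbhs_cubeP[r r0 hr].
have : (mu ((@rowT R N) @^-1` cube x r) <= mu A)%E.
  apply: le_measure; rewrite ?inE//; first exact: measurable_cubeT.
  move=> t /hr[Ot gft]; apply: sA => /= /(_ Ot); by rewrite leNgt gft.
by rewrite lebesgueN_cube// A0 lee_fin leNgt exprn_gt0//; lra.
Unshelve. all: end_near. Qed.

End MeasureRN.

(** * Mollification of distributional solutions *)

Section Mollifier.
Context {R : realType} {N : nat}.
Local Notation E := 'rV[R]_N.
Local Notation e_ i := (delta_mx (0 : 'I_1) i : E).
Local Notation mu := (@lebesgueN R N).
Local Notation integral_over := (@Defs.integralN R N).
Variables (F : nat -> R -> R) (e : R).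
Hypothesis e0 : 0 < e.
Hypothesis Fd : forall k t, is_derive t (1 : R) (F k) (F k.+1 t).
Hypothesis Fsupp : forall k t, e <= `|t| -> F k t = 0.
Hypothesis F0 : forall t, 0 <= F 0%N t.
Hypothesis Fpos : forall t, `|t| < e -> 0 < F 0%N t.
Variable Omega : set E.
Hypothesis oOmega : open Omega.
Hypothesis bOmega : bounded_set Omega.
Implicit Types (k : 'I_N -> nat) (i j : 'I_N) (x y z : E) (h : E -> R).

Local Notation ker := (@kern R N F).
Local Notation k0 := (fun=> 0%N).
Local Notation D := ((@rowT R N) @^-1` Omega).

Lemma continuous_kern_shift k x : continuous (fun y => ker k (y - x)).
Proof.
move=> y; apply: (@continuous_comp _ _ _ (fun y : E => y - x) (ker k)).
  by apply: (@cts_addf R E E (fun y => y) (fun=> - x)); [exact: cvg_id|exact: cts_cstf].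
exact: continuous_kern.
Qed.

Lemma kern_shift_supp k x y : ~ cube x e y -> ker k (y - x) = 0.
Proof.
move=> ny; apply: (kern_supp Fsupp) => hy; apply: ny => j; have := hy j.
by rewrite !mxE subr0.
Qed.

Lemma bdd_continuous_kern k x : bdd_continuous_on Omega (fun y => ker k (y - x)).
Proof.
split=> [y _|]; first exact: continuous_kern_shift.
by have [B _ hB] := kern_bounded Fd Fsupp (N := N) k; exists B.
Qed.

Lemma kern0_ge0 z : 0 <= ker k0 z.
Proof. by apply: prodr_ge0. Qed.

(** Written as a product of one-dimensional integrals so that it visibly does not
depend on where the kernel is centred. *)
Definition kernel_mass : R := fine (\prod_(j < N) \int[lebesgue_measure]_s (F 0%N s)%:E)%E.

Lemma integral_kern x : cube x e `<=` Omega ->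
  integral_over Omega (fun y => ker k0 (y - x)) = kernel_mass.
Proof.
move=> hx; rewrite /Defs.integralN Rintegral_mkcond /Rintegral /kernel_mass; congr fine.
have Fc : continuous (F 0%N).
  by move=> t; exact: (@is_derive_continuous _ _ (F 1%N)).
transitivity (\int[mu]_t (\prod_j (F 0%N (tnth t j - x 0 j)))%:E)%E.
  apply: eq_integral => t _; congr EFin; rewrite /patch; case: ifPn => [_|].
    by apply: eq_bigr => j _; rewrite !mxE.
  rewrite notin_setE => nt; have : ker k0 (rowT t - x) = 0.
    by apply: kern_shift_supp => h; apply: nt; exact: hx.
  move=> z0; transitivity (0 : R) => //; rewrite -z0.
  by apply: eq_bigr => j _; rewrite !mxE.
rewrite (integral_tensor (g := fun j s => F 0%N (s - x 0 j)))//; last first.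
  move=> j; apply: continuous_measurable_fun => s.
  apply: (@continuous_comp _ _ _ (fun s : R => s - x 0 j)); last exact: Fc.
  by apply: cts_addf; [exact: cvg_id|exact: cts_cstf].
by apply: eq_bigr => j _; rewrite -lebesgue_translation.
Qed.

Lemma kernel_mass_gt0 x : cube x e `<=` Omega -> 0 < kernel_mass.
Proof.
move=> hx; rewrite -(integral_kern hx).
have k00 : 0 < ker k0 0.
  by apply: prodr_gt0 => j _; apply: Fpos; rewrite mxE normr0.
pose c := ker k0 0 / 2.
have c0 : 0 < c by rewrite /c; lra.
have [r r0 hr] : exists2 r : R, 0 < r & cube x r `<=` [set y | c < ker k0 (y - x)].
  apply: nbhs_cubeP.
  have hn : nbhs (ker k0 (x - x)) [set s | c < s].
    by apply: open_nbhs_nbhs; split; [exact: open_gt|rewrite /= subrr /c; lra].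
  exact: (continuous_kern_shift hn).
pose s := Num.min r e.
have s0 : 0 < s by rewrite lt_min r0.
have sr : s <= r by rewrite ge_min lexx.
have se : s <= e by rewrite ge_min lexx orbT.
have mD := measurable_openT oOmega.
have kr := bdd_continuous_kern k0 x.
have ki := bdd_continuous_integrable oOmega bOmega kr.
rewrite -lte_fin /Defs.integralN fineK; last exact: integrable_fin_num.
have mC := @measurable_cubeT R N x s.
have CD : (@rowT R N) @^-1` cube x s `<=` D by move=> t; exact/(subset_trans (cubeW se) hx).
apply: (@lt_le_trans _ _ (\int[mu]_(t in (@rowT R N) @^-1` cube x s) (ker k0 (rowT t - x))%:E)%E).
  apply: (@lt_le_trans _ _ (\int[mu]_(t in (@rowT R N) @^-1` cube x s) c%:E)%E).
    rewrite integral_cst// [X in (_ * X)%E](@lebesgueN_cube R N x s s0).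
    by rewrite -EFinM lte_fin mulr_gt0// exprn_gt0// mulr_gt0.
  apply: ge0_le_integral => //.
  - by move=> t _; rewrite lee_fin ltW.
  - by apply: measurable_funS CD _ => //; exact: (measurable_int mu ki).
  - by move=> t ht; rewrite lee_fin; apply/ltW/hr; exact: (cubeW sr).
apply: ge0_subset_integral => //.
- exact: (measurable_int mu ki).
- by move=> t _; rewrite lee_fin kern0_ge0.
Qed.

(** Convolution with the unnormalized kernel of multi-index k; k records the
derivatives that have been moved onto the kernel. *)
Definition mollify h k x : R := integral_over Omega (fun y => h y * ker k (y - x)).

Lemma bdd_continuous_mollify h k x C : (forall y, Omega y -> {for y, continuous h}) ->
  (forall y, cube x e y -> Omega y -> `|h y| <= C) ->
  bdd_continuous_on Omega (fun y => h y * ker k (y - x)).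
Proof.
move=> hc hC; split=> [y Oy|].
  by apply: cts_mulf; [exact: hc|exact: continuous_kern_shift].
have [B B0 hB] := kern_bounded Fd Fsupp (N := N) k.
exists (`|C| * B) => y Oy; have [xy|xy] := pselect (cube x e y).
  rewrite normrM ler_pM// (le_trans (hC _ xy Oy))//; exact: ler_norm.
by rewrite kern_shift_supp// mulr0 normr0 mulr_ge0.
Qed.

(** Stated with both bounds because approximation of a continuous function is
the case of a range of small width. *)
Lemma mollify_range h x a b : (forall y, Omega y -> {for y, continuous h}) ->
  cube x e `<=` Omega -> (forall y, cube x e y -> a <= h y <= b) ->
  a * kernel_mass <= mollify h k0 x <= b * kernel_mass.
Proof.
move=> hc hx hab.
have kr := bdd_continuous_kern k0 x.
have cr : bdd_continuous_on Omega (fun y => h y * ker k0 (y - x)).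
  apply: (@bdd_continuous_mollify _ _ _ (`|a| + `|b|)) => // y xy _.
  have := hab _ xy; rewrite ler_norml.
  have := ler_norm b; have := ler_norm (- a); rewrite normrN.
  have := normr_ge0 a; have := normr_ge0 b; lra.
rewrite -(integral_kern hx) -!(integralN_scale oOmega bOmega)//.
have nr c := bdd_continuous_scale c kr.
apply/andP; split; apply: integralN_le => // y Oy.
all: have [xy|xy] := pselect (cube x e y); last by rewrite kern_shift_supp// !mulr0.
all: have /andP[? ?] := hab _ xy; rewrite ler_wpM2r//; exact: kern0_ge0.
Qed.

(** The minus sign comes from differentiating the kernel with respect to its
centre. *)
Lemma is_derive_mollify h k x i : bdd_continuous_on Omega h ->
  is_derive x (e_ i) (mollify h k) (- mollify h (incr k i) x).
Proof.
move=> hr; have [B B0 hB] := kern_taylor Fd Fsupp k i.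
have [C hC] := hr.2.
apply: (@is_derive_quadratic_remainder _ _ _ _ _ _ (`|C| * B * volume Omega) 1) => // s _.
have kr m z : bdd_continuous_on Omega (fun y => h y * ker m (y - z)).
  by apply: bdd_continuous_mul => //; exact: bdd_continuous_kern.
have n1 := bdd_continuous_scale (-1) (kr k x).
have n2 := bdd_continuous_scale s (kr (incr k i) x).
have n3 := bdd_continuous_add n1 n2.
rewrite /mollify.
have -> : integral_over Omega (fun y => h y * ker k (y - (x + s *: e_ i))) -
    integral_over Omega (fun y => h y * ker k (y - x)) -
    s * - integral_over Omega (fun y => h y * ker (incr k i) (y - x)) =
   integral_over Omega (fun y => h y * ker k (y - (x + s *: e_ i)) +
     (-1 * (h y * ker k (y - x)) + s * (h y * ker (incr k i) (y - x)))).
  rewrite (integralN_add oOmega bOmega (kr k _) n3) (integralN_add oOmega bOmega n1 n2).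
  by rewrite !(integralN_scale oOmega bOmega)//; ring.
have -> : `|C| * B * volume Omega * s ^+ 2 = (`|C| * (B * s ^+ 2)) * volume Omega by ring.
apply: (integralN_norm_le oOmega bOmega (bdd_continuous_add (kr k _) n3)) => y Oy.
have -> : h y * ker k (y - (x + s *: e_ i)) +
     (-1 * (h y * ker k (y - x)) + s * (h y * ker (incr k i) (y - x))) =
   h y * (ker k (y - x - s *: e_ i) - ker k (y - x) - s * - ker (incr k i) (y - x)).
  by have -> : y - (x + s *: e_ i) = y - x - s *: e_ i; [rewrite opprD addrA|ring].
rewrite normrM ler_pM//; first exact: le_trans (hC _ Oy) (ler_norm _).
Qed.

Lemma pjet_mollify h : bdd_continuous_on Omega h ->
  pjet setT (mollify h k0) (fun i x => - mollify h (incr k0 i) x)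
    (fun i x => mollify h (incr (incr k0 i) i) x).
Proof.
move=> hr x _ i; split; first exact: is_derive_mollify.
rewrite -[X in is_derive _ _ _ X]opprK.
by apply: is_deriveN; exact: is_derive_mollify.
Qed.

(** The kernel centred at x is a test function, so the equation may be tested
against it. *)
Lemma laplacian_mollify u f x : bdd_continuous_on Omega u -> distributional_poisson Omega u f ->
  cube x e `<=` Omega ->
  \sum_i mollify u (incr (incr k0 i) i) x = - mollify f k0 x.
Proof.
move=> ur up hx.
have kr m z : bdd_continuous_on Omega (fun y => u y * ker m (y - z)).
  by apply: bdd_continuous_mul => //; exact: bdd_continuous_kern.
rewrite /mollify -(up _ (test_function_kern Fd Fsupp k0 hx)).
have [sr sE] : bdd_continuous_on Omega (fun y => \sum_i u y * ker (incr (incr k0 i) i) (y - x)) /\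
    integral_over Omega (fun y => \sum_i u y * ker (incr (incr k0 i) i) (y - x)) =
    \sum_i mollify u (incr (incr k0 i) i) x.
  elim: (index_enum _) => [|i s [IH1 IH2]].
    rewrite big_nil (_ : (fun _ => _) = (fun=> 0)); last by apply/funext => y; rewrite big_nil.
    split; first by split=> [y _|]; [exact: cts_cstf|exists 0 => y _; rewrite normr0].
    by rewrite /Defs.integralN /Rintegral integral0.
  rewrite big_cons (_ : (fun _ => _) = (fun y => u y * ker (incr (incr k0 i) i) (y - x) +
     \sum_(j <- s) u y * ker (incr (incr k0 j) j) (y - x))); last first.
    by apply/funext => y; rewrite big_cons.
  split; first exact: bdd_continuous_add.
  by rewrite (integralN_add oOmega bOmega (kr _ _) IH1) IH2.
rewrite -sE -[LHS]opprK -[X in - X]mulN1r -(integralN_scale oOmega bOmega)//.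
congr (- _); apply: eq_integralN => y Oy.
by rewrite (laplacian_kern Fd) -mulr_sumr; ring.
Qed.

End Mollifier.

(** * Interior regularity of distributional solutions *)

Section Differentiability.
Context {R : realType} {N : nat}.
Local Notation E := 'rV[R]_N.
Local Notation e_ i := (delta_mx (0 : 'I_1) i : E).

Lemma coord_le_norm (x : E) i : `|x 0 i| <= `|x|.
Proof.
have [->|x0] := eqVneq x 0; first by rewrite mxE normr0.
apply/ler_addgt0Pr => t t0.
have : ball (0 : E) (`|x| + t) x by rewrite -ball_normE /ball_/= sub0r normrN ltrDl.
by case=> _ /(_ 0 i); rewrite /ball/= mxE sub0r normrN => /ltW.
Qed.

Lemma differentiable_flat (V : normedModType R) (f : V -> R) (x : V) :
  (forall t, 0 < t -> \forall h \near (0 : V), `|f (h + x) - f x| <= t * `|h|) ->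
  differentiable f x.
Proof.
move=> hf.
have H : f \o shift x = cst (f x) + (\0 : V -> R) +o_ 0 id.
  apply/eqaddoP => t t0; apply: filterS (hf t t0) => h.
  by rewrite !fctE/= addr0.
have c0 : continuous (\0 : V -> R) by move=> y; exact: cvg_cst.
have h0 := @diff_unique R V R f \0 x c0 H.
by apply/diff_locallyP; split; rewrite h0.
Qed.

(** Subtracting the linear part reduces to a function with zero differential,
where the sup norm of the space controls the sum of coordinates. *)
Lemma differentiable_coord_expansion (f : E -> R) (x : E) (l : 'I_N -> R) :
  (forall t, 0 < t -> exists2 r : R, 0 < r & forall y, cube x r y ->
     `|f y - f x - \sum_i l i * (y 0 i - x 0 i)| <= t * \sum_i `|y 0 i - x 0 i|) ->
  differentiable f x /\ forall i, is_derive x (e_ i) f (l i).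
Proof.
move=> hf; split; last first.
  move=> i; apply: is_derive_little => t t0; have [r r0 hr] := hf t t0.
  exists r => // h hr'.
  have hc j : (x + h *: e_ i) 0 j - x 0 j = (j == i)%:R * h by rewrite shift_coordE addrC addKr.
  have s1 : \sum_j l j * ((x + h *: e_ i) 0 j - x 0 j) = h * l i.
    rewrite (bigD1 i)//= big1 ?addr0; first by rewrite hc eqxx mul1r mulrC.
    by move=> j /negPf ji; rewrite hc ji mul0r mulr0.
  have s2 : \sum_j `|(x + h *: e_ i) 0 j - x 0 j| = `|h|.
    rewrite (bigD1 i)//= big1 ?addr0; first by rewrite hc eqxx mul1r.
    by move=> j /negPf ji; rewrite hc ji mul0r normr0.
  have := hr (x + h *: e_ i); rewrite s1 s2; apply => j.
  by rewrite hc; case: (j == i); rewrite ?mul1r ?mul0r ?normr0; exact: ltW.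
pose g (y : E) := \sum_i l i * y 0 i.
have gd : differentiable g x.
  rewrite (_ : g = \sum_i (l i \*: (fun y : E => y 0 i))); last first.
    by apply/funext => y; rewrite fct_sumE.
  by apply: differentiable_sum => i; apply: differentiableZ; exact: differentiable_coord.
rewrite (_ : f = (f - g) + g); last by rewrite subrK.
apply: differentiableD => //; apply: differentiable_flat => t t0.
have N1 : 0 < t / (N%:R + 1) by rewrite divr_gt0// ltr_wpDl.
have [r r0 hr] := hf _ N1.
near=> h.
have hhr : `|h| < r by near: h; apply: (@nbhs0_lt R E).
have := hr (h + x); rewrite !fctE.
have hc j : (h + x) 0 j - x 0 j = h 0 j by rewrite mxE addrK.
under eq_bigr do rewrite hc.
under [X in _ * X]eq_bigr do rewrite hc.
have -> : f (h + x) - g (h + x) - (f x - g x) = f (h + x) - f x - \sum_i l i * h 0 i.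
  rewrite /g; under [X in _ - X - _]eq_bigr do rewrite mxE mulrDr.
  by rewrite big_split/=; ring.
move=> H; apply: le_trans (H _) _ => [j|].
  by rewrite hc; apply/ltW/(le_lt_trans (coord_le_norm _ _)).
apply: (@le_trans _ _ (t / (N%:R + 1) * (N%:R * `|h|))).
  rewrite ler_wpM2l ?(ltW N1)//.
  apply: (@le_trans _ _ (\sum_(i < N) `|h|)); first by apply: ler_sum => i _; exact: coord_le_norm.
  by rewrite sumr_const card_ord mulr_natl.
have N0 : 0 < N%:R + 1 :> R by rewrite ltr_wpDl.
rewrite mulrA ler_wpM2r// mulrAC ler_pdivrMr//.
by rewrite ler_wpM2l ?(ltW t0)// lerDl.
Unshelve. all: end_near. Qed.

Lemma lipschitz_continuous (f : E -> R) (L : R) :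
  (forall x y, `|f y - f x| <= L * \sum_i `|y 0 i - x 0 i|) -> continuous f.
Proof.
move=> hf x; apply/(@cvgrPdist_le R R E (nbhs x) _ f (f x)) => t t0.
pose c := `|L| * N%:R + 1.
have c0 : 0 < c by rewrite ltr_wpDl// mulr_ge0.
near=> y; rewrite distrC; apply: le_trans (hf x y) _.
have : cube x (t / c) y by near: y; apply: nbhs_cube; exact: divr_gt0.
move=> hy; apply: (@le_trans _ _ (`|L| * \sum_(i < N) (t / c))).
  apply: (@le_trans _ _ (`|L| * \sum_i `|y 0 i - x 0 i|)).
    by rewrite ler_wpM2r ?ler_norm// sumr_ge0.
  by rewrite ler_wpM2l// ler_sum.
rewrite sumr_const card_ord -[(t / c) *+ _]mulr_natl.
have -> : `|L| * (N%:R * (t / c)) = `|L| * N%:R * t / c by ring.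
rewrite ler_pdivrMr//.
by rewrite mulrC ler_wpM2l ?(ltW t0)// /c; lra.
Unshelve. all: end_near. Qed.

Lemma bounded_partials_continuous (f : E -> R) (D : 'I_N -> E -> R) :
  (forall z i, is_derive z (e_ i) f (D i z)) ->
  (forall i, exists C, forall z, `|D i z| <= C) -> continuous f.
Proof.
move=> fd /choice[C hC].
apply: (@lipschitz_continuous _ (\sum_i `|C i|)) => x y.
have hxy : cube x (\sum_j `|y 0 j - x 0 j|) y.
  by move=> j; rewrite (bigD1 j)//= lerDl sumr_ge0.
have := @coord_mvt R N f D (fun=> 0) (fun=> \sum_i `|C i|) x _ (fun z _ i => fd z i) _ y hxy.
have -> : \sum_i 0 * (y 0 i - x 0 i) = 0 by rewrite big1// => i _; rewrite mul0r.
rewrite subr0 mulr_sumr; apply => z _ i; rewrite subr0.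
apply: (le_trans (hC i z)); apply: (le_trans (ler_norm _)).
by rewrite (bigD1 i)//= lerDl sumr_ge0.
Qed.

End Differentiability.

Section UniformApproximation.
Context {R : realType} {N : nat}.
Local Notation E := 'rV[R]_N.
Local Notation e_ i := (delta_mx (0 : 'I_1) i : E).

(** Uniform continuity on a compact cube, with a margin d that also keeps the
slightly enlarged cube inside Omega: mollification at x sees a neighbourhood
of x. *)
Lemma uniform_continuity_cube (Omega : set E) (g : E -> R) x s (t : R) : 0 < t ->
  open Omega -> (forall y, Omega y -> {for y, continuous g}) -> cube x s `<=` Omega ->
  \forall d \near (0 : R)^'+, forall y, cube x s y ->
     cube y d `<=` Omega /\ forall z, cube y d z -> `|g z - g y| <= t.
Proof.
move=> t0 oO gc hx.
have /compact_near_coveringP := @cube_compact R N x s.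
move=> /(_ _ _ (fun d y => cube y d `<=` Omega /\ forall z, cube y d z -> `|g z - g y| <= t)
  (at_right_proper_filter (0 : R))); apply => y /hx Oy.
have t2 : 0 < t / 2 by lra.
have h : \forall z \near y, Omega z /\ `|g y - g z| <= t / 2.
  near=> z; split; near: z; first exact: open_nbhs_nbhs.
  by have /cvgrPdist_le/(_ _ t2) := gc y Oy.
have [r r0 hr] := nbhs_cubeP h.
exists (cube y (r / 2), [set d : R | d <= r / 2]) => /=.
  split; first by apply: nbhs_cube; lra.
  by apply: nbhs_right_le; lra.
move=> [z d] [/= yz dr].
have hz w : cube z d w -> cube y r w.
  by move=> zw; apply: (cubeW (r := r / 2 + d)); [lra|exact: cube_trans yz zw].
split=> [w /hz /hr []//|w /hz /hr [_ hw]].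
have [_ hyz] : Omega z /\ `|g y - g z| <= t / 2.
  by apply: hr; apply: cubeW yz; lra.
have -> : g w - g z = (g y - g z) - (g y - g w) by ring.
by rewrite (le_trans (ler_normB _ _))//; lra.
Unshelve. all: end_near. Qed.

(** An approximate solution: twice differentiable along the axes, within t of
u, and with Laplacian within t of - f. *)
Definition poisson_approx (A : set E) (u f : E -> R) (t : R) (w : E -> R)
    (D H : 'I_N -> E -> R) : Prop :=
  [/\ pjet setT w D H, continuous w, forall i, continuous (D i) &
      forall y, A y -> `|w y - u y| <= t /\ `|\sum_i H i y + f y| <= t].

Variables (Omega : set E) (u f : E -> R).
Hypothesis oOmega : open Omega.
Hypothesis bOmega : bounded_set Omega.
Hypothesis ur : bdd_continuous_on Omega u.
Hypothesis fc : forall x, Omega x -> {for x, continuous f}.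
Hypothesis up : distributional_poisson Omega u f.

Lemma poisson_approx_exists x s (t : R) : 0 < t -> 0 <= s -> cube x s `<=` Omega ->
  exists w D H, poisson_approx (cube x s) u f t w D H.
Proof.
move=> t0 s0 hx.
have hu := @uniform_continuity_cube Omega u x s t t0 oOmega ur.1 hx.
have hf := @uniform_continuity_cube Omega f x s t t0 oOmega fc hx.
have [d [d0 [hdu hdf]]] : exists d : R, 0 < d /\
    ((forall y, cube x s y -> cube y d `<=` Omega /\ forall z, cube y d z -> `|u z - u y| <= t) /\
    (forall y, cube x s y -> cube y d `<=` Omega /\ forall z, cube y d z -> `|f z - f y| <= t)).
  apply: (@filter_ex _ ((0 : R)^'+)); near=> d; split; first by near: d; exact: nbhs_right_gt.
  by split; near: d.
have [F [Fd Fs F0 Fp]] := bump_exists d0.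
pose m := @kernel_mass R N F.
have m0 : 0 < m.
  by apply: (kernel_mass_gt0 d0 Fd Fs F0 Fp oOmega bOmega (hdu x (cube_center _ s0)).1).
have mV : m^-1 * m = 1 by rewrite mulVf// gt_eqF.
pose k0 := (fun=> 0%N) : 'I_N -> nat.
have cj := pjet_mollify Fd Fs oOmega bOmega ur.
have avg g y a : (forall y, Omega y -> {for y, continuous g}) ->
    cube y d `<=` Omega -> (forall z, cube y d z -> `|g z - a| <= t) ->
    `|m^-1 * mollify F Omega g k0 y - a| <= t.
  move=> gc hy hg.
  have hab z : cube y d z -> a - t <= g z <= a + t.
    by move=> /hg; rewrite ler_norml; lra.
  have /andP[h1 h2] := mollify_range Fd Fs F0 oOmega bOmega gc hy hab.
  have m1 : 0 < m^-1 by rewrite invr_gt0.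
  rewrite ler_norml lerBlDr lerBrDr; apply/andP; split.
    by rewrite mulrC ler_pdivlMr// (le_trans _ h1)// ler_wpM2r ?(ltW m0)//; lra.
  by rewrite mulrC ler_pdivrMr// (le_trans h2)// ler_wpM2r ?(ltW m0)//; lra.
have cc k : continuous (mollify F Omega u k).
  apply: (@bounded_partials_continuous R N _ (fun i y => - mollify F Omega u (incr k i) y)).
    by move=> z i; exact: (is_derive_mollify Fd Fs oOmega bOmega).
  move=> i; have [B B0 hB] := kern_bounded Fd Fs (incr k i) (N := N).
  have [C hC] := ur.2.
  exists (`|C| * B * volume Omega) => z; rewrite normrN.
  apply: integralN_norm_le => //.
    by apply: bdd_continuous_mul => //; exact: (bdd_continuous_kern Fd Fs).
  by move=> y0 Oy; rewrite normrM ler_pM// (le_trans (hC _ Oy))// ler_norm.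
exists (fun y => m^-1 * mollify F Omega u k0 y),
  (fun i y => m^-1 * - mollify F Omega u (incr k0 i) y),
  (fun i y => m^-1 * mollify F Omega u (incr (incr k0 i) i) y); split.
- exact: pjet_scale.
- by move=> y; apply: (@cts_scalef R E); exact: cc.
- move=> i y; apply: (@cts_scalef R E).
  exact: (cvgN (cc (incr k0 i) y)).
- move=> y xy; split; first by apply: avg; [exact: ur.1|exact: (hdu y xy).1|exact: (hdu y xy).2].
  rewrite -mulr_sumr (laplacian_mollify Fd Fs oOmega bOmega ur up (hdu y xy).1).
  rewrite mulrN addrC distrC; apply: avg => //; first exact: (hdu y xy).1.
  exact: (hdf y xy).2.
Unshelve. all: end_near. Qed.

Local Notation approx := poisson_approx.

(** The difference of two approximate solutions is small with small Laplacian,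
so the estimate on cubes of half side s / 2 makes its gradient small. *)
Lemma approx_gradient x s (t t' : R) w D H w' D' H' : 0 < s -> 0 < t -> 0 < t' ->
  approx (cube x s) u f t w D H -> approx (cube x s) u f t' w' D' H' ->
  forall y, cube x (s / 2) y -> forall i,
  `|D' i y - D i y| <= (N%:R / (s / 2) + s / 2) * (t + t').
Proof.
move=> s0 t0 t'0 [wj wc _ wa] [w'j w'c _ w'a] y xy i.
have s2 : 0 < s / 2 by lra.
have sub z : cube y (s / 2) z -> cube x s z.
  by move=> yz; apply: (cubeW (r := s / 2 + s / 2)); [lra|exact: cube_trans xy yz].
have -> : D' i y - D i y = D' i y + -1 * D i y by ring.
have -> : (N%:R / (s / 2) + s / 2) * (t + t') =
  N%:R * (t + t') / (s / 2) + (s / 2) * (2 * (t + t')) / 2 by field; exact: lt0r_neq0.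
apply: (@gradient_estimate R N (fun z => w' z + -1 * w z) (fun i z => D' i z + -1 * D i z)
  _ y (s / 2) (t + t') (2 * (t + t')) i s2 (pjet_add w'j (pjet_scale (-1) wj))).
- by move=> z; apply: (@cts_addf R E); [exact: w'c|apply: (@cts_scalef R E); exact: wc].
- move=> z /sub xz; have [h1 _] := wa z xz; have [h2 _] := w'a z xz.
  have -> : w' z + -1 * w z = (w' z - u z) - (w z - u z) by ring.
  by rewrite (le_trans (ler_normB _ _))// addrC lerD.
- move=> z /sub xz; have [_ h1] := wa z xz; have [_ h2] := w'a z xz.
  rewrite big_split/= -mulr_sumr.
  have -> : \sum_j H' j z + -1 * \sum_j H j z =
    (\sum_j H' j z + f z) - (\sum_j H j z + f z) by ring.
  by rewrite (le_lt_trans (ler_normB _ _))//; lra.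
Qed.

(** Compare w with a second approximation w' and let the quality of w' improve:
the increments of w' - w are controlled by the gradients and tend to those of
u - w. *)
Lemma approx_increment x s (t : R) w D H : 0 < s -> 0 < t -> cube x s `<=` Omega ->
  approx (cube x s) u f t w D H -> forall y, cube x (s / 2) y ->
  `|(u y - u x) - (w y - w x)| <=
    (N%:R / (s / 2) + s / 2) * (2 * t) * \sum_i `|y 0 i - x 0 i|.
Proof.
move=> s0 t0 hx wA y xy.
have s2 : 0 < s / 2 by lra.
set C := N%:R / (s / 2) + s / 2.
have C0 : 0 <= C by rewrite addr_ge0 ?divr_ge0// ltW.
apply/ler_addgt0Pr => a a0.
pose t' := Num.min t (a / 2).
have t'0 : 0 < t' by rewrite lt_min t0; lra.
have t't : t' <= t by rewrite ge_min lexx.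
have t'a : t' <= a / 2 by rewrite ge_min lexx orbT.
have [w' [D' [H' w'A]]] := poisson_approx_exists t'0 (ltW s0) hx.
have hD := approx_gradient s0 t0 t'0 wA w'A.
have [wj _ _ wa] := wA; have [w'j _ _ w'a] := w'A.
have dj := pjet_add w'j (pjet_scale (-1) wj).
have xx : cube x s x by exact: cube_center (ltW s0).
have ys : cube x s y by apply: cubeW xy; lra.
have := @coord_mvt R N _ _ (fun=> 0) (fun=> C * (2 * t)) x (s / 2)
  (fun z _ i => (dj z I i).1) _ y xy.
have -> : \sum_i 0 * (y 0 i - x 0 i) = 0 by rewrite big1// => i _; rewrite mul0r.
rewrite subr0 -mulr_sumr => /(_ _) H0.
have {H0} H1 : `|w' y + -1 * w y - (w' x + -1 * w x)| <= C * (2 * t) * \sum_i `|y 0 i - x 0 i|.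
  apply: H0 => z xz i; rewrite subr0 mulN1r.
  by apply: (le_trans (hD z xz i)); rewrite ler_wpM2l//; lra.
have [h1 _] := w'a y ys; have [h2 _] := w'a x xx.
have -> : u y - u x - (w y - w x) =
  (w' y + -1 * w y - (w' x + -1 * w x)) - ((w' y - u y) - (w' x - u x)) by ring.
apply: (le_trans (ler_normB _ _)); apply: lerD => //.
by apply: (le_trans (ler_normB _ _)); lra.
Qed.

(** The gradients of approximate solutions form a Cauchy family.  Its limit is
taken as a supremum of the lower bounds D i x - C t over all approximations, which
avoids choosing a sequence; the gradient estimate for smooth functions then passes
to the limit. *)
Theorem interior_gradient x s (M K : R) : 0 < s -> cube x s `<=` Omega ->
  (forall y, cube x s y -> `|u y| <= M) -> (forall y, cube x s y -> `|f y| <= K) ->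
  differentiable u x /\ forall i, `|partial i u x| <= N%:R * M / s + s * K / 2.
Proof.
move=> s0 hx uM fK.
have s2 : 0 < s / 2 by lra.
pose C := N%:R / (s / 2) + s / 2.
have C0 : 0 < C by rewrite ltr_wpDl// divr_ge0// ltW.
have xx2 : cube x (s / 2) x by exact: cube_center (ltW s2).
have xx : cube x s x by exact: cube_center (ltW s0).
pose A i := [set a : R | exists (t : R) w D H,
  [/\ 0 < t, approx (cube x s) u f t w D H & a = D i x - C * t]].
pose l i := sup (A i).
have hl i (t : R) w D H : 0 < t -> approx (cube x s) u f t w D H ->
    `|D i x - l i| <= C * t.
  move=> t0 wA.
  have ub t' w' D' H' : 0 < t' -> approx (cube x s) u f t' w' D' H' ->
      ubound (A i) (D' i x + C * t').
    move=> t'0 w'A _ [t1 [w1 [D1 [H1 [t10 w1A ->]]]]].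
    have := approx_gradient s0 t10 t'0 w1A w'A xx2 i.
    by rewrite -/C ler_norml mulrDr; lra.
  have ne : A i (D i x - C * t) by exists t, w, D, H.
  have h1 : l i <= D i x + C * t by apply: ge_sup; [exists (D i x - C * t)|exact: ub wA].
  have h2 : D i x - C * t <= l i.
    by apply: ub_le_sup => //; exists (D i x + C * t); exact: ub wA.
  by rewrite ler_norml; lra.
have [|ud ul] := @differentiable_coord_expansion R N u x l.
  move=> a a0.
  pose t := a / (3 * C + 1).
  have c1 : 0 < 3 * C + 1 by lra.
  have t0 : 0 < t by rewrite divr_gt0.
  have [w [D [H wA]]] := poisson_approx_exists t0 (ltW s0) hx.
  have hinc := approx_increment s0 t0 hx wA.
  have [wj wc Dc wa] := wA.
  have : \forall z \near x, forall i, `|D i x - D i z| <= t.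
    apply: (@filter_forall _ 'I_N (fun i z => `|D i x - D i z| <= t) (nbhs x) _) => i.
    by have /(@cvgrPdist_le R R E (nbhs x) _ (D i) (D i x))/(_ _ t0) := Dc i x.
  move=> /nbhs_cubeP[r r0 hr].
  exists (Num.min r (s / 2)) => [|y xy]; first by rewrite lt_min r0.
  have xyr : cube x r y by apply: cubeW xy; rewrite ge_min lexx.
  have xys : cube x (s / 2) y by apply: cubeW xy; rewrite ge_min lexx orbT.
  have h1 := hinc y xys; rewrite -/C in h1.
  have h2 := @coord_mvt R N w D (fun i => D i x) (fun=> t) x r
    (fun z _ i => (wj z I i).1) _ y xyr.
  have {}h2 : `|w y - w x - \sum_i D i x * (y 0 i - x 0 i)| <= t * \sum_i `|y 0 i - x 0 i|.
    by rewrite mulr_sumr; apply: h2 => z xz i; rewrite distrC; exact: hr.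
  have h3 : `|\sum_i (D i x - l i) * (y 0 i - x 0 i)| <= C * t * \sum_i `|y 0 i - x 0 i|.
    rewrite (le_trans (ler_norm_sum _ _ _))// mulr_sumr ler_sum// => i _.
    by rewrite normrM ler_wpM2r//; exact: hl wA.
  have -> : u y - u x - \sum_i l i * (y 0 i - x 0 i) =
     (u y - u x - (w y - w x)) + (w y - w x - \sum_i D i x * (y 0 i - x 0 i)) +
     \sum_i (D i x - l i) * (y 0 i - x 0 i).
    under [X in _ = _ + X]eq_bigr do rewrite mulrBl.
    by rewrite sumrB; ring.
  apply: (le_trans (ler_normD _ _)).
  apply: (le_trans (lerD (le_trans (ler_normD _ _) (lerD h1 h2)) h3)).
  rewrite -!mulrDl ler_wpM2r ?sumr_ge0//.
  by rewrite le_eqVlt; apply/orP; left; apply/eqP; rewrite /t; field; exact: lt0r_neq0.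
split=> // i; have := ul i; rewrite /partial => h; rewrite derive_val.
apply/ler_addgt0Pr => a a0.
pose c := N%:R / s + s + C.
have c0 : 0 < c by rewrite ltr_wpDl// addr_ge0 ?divr_ge0// ltW.
pose t := a / c.
have t0 : 0 < t by rewrite divr_gt0.
have [w [D [H wA]]] := poisson_approx_exists t0 (ltW s0) hx.
have h1 := hl i t w D H t0 wA.
have [wj wc _ wa] := wA.
have h2 := @gradient_estimate R N w D H x s (M + t) (K + 2 * t) i s0 wj wc.
have {}h2 : `|D i x| <= N%:R * (M + t) / s + s * (K + 2 * t) / 2.
  apply: h2 => y xy; have [g1 g2] := wa y xy.
    have -> : w y = u y + (w y - u y) by ring.
    by rewrite (le_trans (ler_normD _ _))// lerD// uM.
  have -> : \sum_j H j y = (\sum_j H j y + f y) - f y by ring.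
  rewrite (le_lt_trans (ler_normB _ _))//; have := fK y xy; lra.
have -> : l i = D i x - (D i x - l i) by ring.
apply: (le_trans (ler_normB _ _)); apply: (le_trans (lerD h2 h1)).
rewrite le_eqVlt; apply/orP; left; apply/eqP.
have -> : a = c * t by rewrite /t mulrC divfK// lt0r_neq0.
by rewrite /c; field; exact: lt0r_neq0.
Qed.

End UniformApproximation.

(** * Euclidean norm and distance to the boundary *)

Section EuclideanNorm.
Context {R : realType} {N : nat}.
Local Notation E := 'rV[R]_N.
Implicit Types (x y z : E).

Lemma enorm_ge0 x : 0 <= enorm x.
Proof. exact: sqrtr_ge0. Qed.

Lemma sqr_enorm x : enorm x ^+ 2 = \sum_i x 0 i ^+ 2.
Proof. by rewrite sqr_sqrtr// sumr_ge0// => i _; exact: sqr_ge0. Qed.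

Lemma coord_le_enorm x i : `|x 0 i| <= enorm x.
Proof.
rewrite -sqrtr_sqr ler_sqrt; last by rewrite sumr_ge0// => j _; exact: sqr_ge0.
by rewrite (bigD1 i)//= lerDl sumr_ge0// => j _; exact: sqr_ge0.
Qed.

Lemma enorm_eq0 x : enorm x = 0 -> x = 0.
Proof.
move=> x0; apply/rowP => i; apply/eqP; rewrite mxE -normr_le0 -x0.
exact: coord_le_enorm.
Qed.

Lemma enormN x : enorm (- x) = enorm x.
Proof. by congr Num.sqrt; apply: eq_bigr => i _; rewrite mxE sqrrN. Qed.

Lemma enorm_dist x y : enorm (x - y) = enorm (y - x).
Proof. by rewrite -enormN opprB. Qed.

(** From 2 a b <= t a^2 + b^2 / t in each coordinate, with t the ratio of the two
norms. *)
Lemma ler_enormD x y : enorm (x + y) <= enorm x + enorm y.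
Proof.
have [/enorm_eq0 ->|x0] := eqVneq (enorm x) 0; first by rewrite add0r lerDr enorm_ge0.
have [/enorm_eq0 ->|y0] := eqVneq (enorm y) 0; first by rewrite addr0 lerDl enorm_ge0.
have {}x0 : 0 < enorm x by rewrite lt_neqAle eq_sym x0 enorm_ge0.
have {}y0 : 0 < enorm y by rewrite lt_neqAle eq_sym y0 enorm_ge0.
rewrite -ler_sqr ?nnegrE ?addr_ge0 ?enorm_ge0//.
rewrite sqrrD !sqr_enorm.
pose t := enorm y / enorm x.
have t0 : 0 < t by rewrite divr_gt0.
have : \sum_i (x + y) 0 i ^+ 2 <=
    \sum_i (x 0 i ^+ 2 + (t * x 0 i ^+ 2 + t^-1 * y 0 i ^+ 2) + y 0 i ^+ 2).
  apply: ler_sum => i _; rewrite mxE.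
  have : 0 <= t * (x 0 i - t^-1 * y 0 i) ^+ 2 by rewrite mulr_ge0 ?sqr_ge0// ltW.
  have -> : t * (x 0 i - t^-1 * y 0 i) ^+ 2 =
     t * x 0 i ^+ 2 + t^-1 * y 0 i ^+ 2 - 2 * (x 0 i * y 0 i).
    by field; exact: lt0r_neq0.
  by rewrite sqrrD; lra.
move=> /le_trans; apply; rewrite !big_split/= -!mulr_sumr -!sqr_enorm.
rewrite le_eqVlt; apply/orP; left; apply/eqP; rewrite /t; field.
by rewrite !lt0r_neq0.
Qed.

Lemma enorm_le_sum x : enorm x <= \sum_i `|x 0 i|.
Proof.
rewrite -ler_sqr ?nnegrE ?enorm_ge0 ?sumr_ge0// sqr_enorm expr2 mulr_suml.
apply: ler_sum => i _; rewrite -real_normK ?num_real// expr2 ler_wpM2l//.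
by rewrite (bigD1 i)//= lerDl sumr_ge0.
Qed.

Lemma enorm_cube x y (r : R) : cube x r y -> enorm (y - x) <= N%:R * r.
Proof.
move=> xy; apply: le_trans (enorm_le_sum _) _.
apply: (@le_trans _ _ (\sum_(i < N) r)).
  by apply: ler_sum => i _; have := xy i; rewrite !mxE.
by rewrite sumr_const card_ord mulr_natl.
Qed.

End EuclideanNorm.

Section BoundaryDistance.
Context {R : realType} {N : nat}.
Local Notation E := 'rV[R]_N.
Local Notation e_ i := (delta_mx (0 : 'I_1) i : E).
Implicit Types (x y z : E).
Variable Omega : set E.
Hypothesis N0 : (0 < N)%N.
Hypothesis oOmega : open Omega.
Hypothesis bOmega : bounded_set Omega.
Hypothesis nOmega : Omega !=set0.
Local Notation d := (bdist Omega).

Lemma boundaryE : boundary Omega = closure Omega `\` Omega.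
Proof. by rewrite /boundary (proj1 (interior_id _) oOmega). Qed.

Lemma boundary_notin x : boundary Omega x -> ~ Omega x.
Proof. by rewrite boundaryE => -[]. Qed.

Lemma compact_closure : compact (closure Omega).
Proof.
have [M M0 hM] := bounded_sub_cube bOmega.
apply: (subclosed_compact (@closed_closure _ _) (@cube_compact R N 0 M)).
by have := closure_subset hM; rewrite -(proj1 (closure_id _) (@cube_closed R N 0 M)).
Qed.

(** A point of the closure with maximal first coordinate cannot lie in the
open set. *)
Lemma boundary_nonempty : boundary Omega !=set0.
Proof.
pose i0 : 'I_N := Ordinal N0.
have cne : closure Omega !=set0 by have [x Ox] := nOmega; exists x; exact: subset_closure.
have [|p pc pmax] := @compact_EVT_max _ R (fun y : E => y 0 i0) _ cne compact_closure.
  by apply: continuous_subspaceT => y; exact: cts_coord.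
rewrite inE in pc; exists p; rewrite boundaryE; split => // Op.
have [r r0 hr] := nbhs_cubeP (open_nbhs_nbhs (conj oOmega Op)).
have : Omega (p + r *: e_ i0).
  apply: hr => j; rewrite shift_coordE addrAC subrr add0r normrM (gtr0_norm r0).
  by case: (j == i0); rewrite ?normr1 ?normr0 ?mul1r ?mul0r// ltW.
move=> /subset_closure/mem_set/pmax; rewrite shift_coordE eqxx mul1r; lra.
Qed.

Local Notation dset x := [set enorm (x - y) | y in boundary Omega].

Lemma has_inf_bdist x : has_inf (dset x).
Proof.
split; first by have [q hq] := boundary_nonempty; exists (enorm (x - q)), q.
by exists 0 => _ [q _ <-]; exact: enorm_ge0.
Qed.

Lemma bdist_le x q : boundary Omega q -> d x <= enorm (x - q).
Proof. by move=> hq; apply: ge_inf; [exact: (has_inf_bdist x).2|exists q]. Qed.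

Lemma le_bdist x a : (forall q, boundary Omega q -> a <= enorm (x - q)) -> a <= d x.
Proof. by move=> h; apply: lb_le_inf; [exact: (has_inf_bdist x).1|move=> _ [q hq <-]; exact: h]. Qed.

Lemma bdist_approx x a : d x < a -> exists2 q, boundary Omega q & enorm (x - q) < a.
Proof.
move=> da; have e0 : 0 < a - d x by rewrite subr_gt0.
have [_ [q hq <-] hlt] := inf_adherent e0 (has_inf_bdist x).
exists q => //; move: hlt; rewrite -/(d x); lra.
Qed.

Lemma bdist_lipschitz x y : d y <= d x + enorm (y - x).
Proof.
rewrite -lerBlDr; apply: le_bdist => q hq; rewrite lerBlDr.
apply: (le_trans (bdist_le y hq)).
have -> : y - q = (x - q) + (y - x) by rewrite [RHS]addrC addrA subrK.
exact: ler_enormD.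
Qed.

Lemma continuous_bdist : continuous d.
Proof.
apply: (@lipschitz_continuous R N d 1) => x y; rewrite mul1r.
have h1 := bdist_lipschitz x y; have h2 := bdist_lipschitz y x.
rewrite enorm_dist in h2.
have : enorm (y - x) <= \sum_i `|y 0 i - x 0 i|.
  by apply: le_trans (enorm_le_sum _) _; apply: ler_sum => i _; rewrite !mxE.
by rewrite ler_norml; lra.
Qed.

Lemma bdist_gt0 x : Omega x -> 0 < d x.
Proof.
move=> Ox; have [r r0 hr] := nbhs_cubeP (open_nbhs_nbhs (conj oOmega Ox)).
apply: (lt_le_trans r0); apply: le_bdist => q hq.
rewrite leNgt; apply/negP => qr; apply: (boundary_notin hq); apply: hr => j.
rewrite distrC; have := coord_le_enorm (x - q) j; rewrite !mxE => h.
exact: (le_trans h (ltW qr)).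
Qed.

(** The segment from x to y stays closer to x than the boundary does, so the
last parameter up to which it stays in the closure is its endpoint. *)
Lemma near_in_domain x y : Omega x -> enorm (y - x) < d x -> Omega y.
Proof.
move=> Ox yx.
pose g (t : R) : E := x + t *: (y - x).
have gc : continuous g.
  move=> t; apply: (@cts_addf R R E (fun=> x) (fun t : R => t *: (y - x))).
    exact: cts_cstf.
  by apply: cvgZr_tmp; exact: cvg_id.
pose T := `[0 : R, 1]%classic `&` g @^-1` closure Omega.
have cT : compact T.
  apply: compact_closedI; first exact: segment_compact.
  by apply: closed_comp => [t _|]; [exact: gc|exact: closed_closure].
have T0 : T 0.
  by split; [rewrite /= in_itv/= lexx ler01|rewrite /= /g scale0r addr0; exact: subset_closure].
have [||t tT tmax] := @compact_EVT_max _ R id T _ cT; first by exists 0.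
  by apply: continuous_subspaceT => s; exact: cvg_id.
rewrite inE in tT; case: tT => /=; rewrite in_itv/= => /andP[t0 t1] ct.
have gt : Omega (g t).
  apply: contrapT => nO; have : boundary Omega (g t) by rewrite boundaryE.
  move=> /(bdist_le x); rewrite /g opprD addNKr enormN => h.
  have : enorm (t *: (y - x)) <= enorm (y - x).
    rewrite /enorm ler_sqrt; last by rewrite sumr_ge0// => i _; exact: sqr_ge0.
    apply: ler_sum => i _; rewrite mxE exprMn.
    by rewrite ler_piMl ?sqr_ge0// expr_le1.
  lra.
have [t_eq1|t_neq1] := eqVneq t 1.
  by move: gt; rewrite t_eq1 /g scale1r addrC subrK.
have t_lt1 : t < 1 by rewrite lt_neqAle t_neq1.
have /gc /nbhs_ballP[r /= r0 hr] : nbhs (g t) Omega by exact: open_nbhs_nbhs.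
pose s := Num.min 1 (t + r / 2).
have ts : t < s by rewrite lt_min t_lt1/=; lra.
have sT : T s.
  split; first by rewrite /= in_itv/= ge_min lexx andbT (le_trans t0)// ltW.
  apply: subset_closure; apply: hr; rewrite /ball/= distrC gtr0_norm ?subr_gt0//.
  have : s <= t + r / 2 by rewrite ge_min lexx orbT.
  lra.
have := tmax s (mem_set sT); rewrite leNgt ts; by [].
Qed.

Lemma cube_in_domain x r : Omega x -> N%:R * r < d x -> cube x r `<=` Omega.
Proof.
move=> Ox h y xy; apply: (near_in_domain Ox).
exact: (le_lt_trans (enorm_cube xy)).
Qed.

Lemma C_closure_bdd_continuous (v : E -> R) : C_closure Omega v -> bdd_continuous_on Omega v.
Proof.
move=> vc; split=> [x Ox|].
  have : {within Omega, continuous v} by apply: continuous_subspaceW vc; exact: subset_closure.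
  by rewrite continuous_open_subspace// => /(_ x); apply; rewrite inE.
have [B [_ hB]] := compact_bounded (continuous_compact vc compact_closure).
exists (`|B| + 1) => x Ox; apply: hB; first by rewrite (le_lt_trans (ler_norm B))// ltrDl.
by exists x => //; exact: subset_closure.
Qed.

End BoundaryDistance.

(** * Boundary charts *)

Section SmoothClass.
Context {R : realType} {N : nat}.
Local Notation E := 'rV[R]_N.
Local Notation e_ i := (delta_mx (0 : 'I_1) i : E).

Lemma C2_jet (U : set E) (f : E -> R) : C_on 2 U f ->
  pjet U f (fun i => partial i f) (fun i => partial i (partial i f)).
Proof.
move=> fC x Ux i; split.
  by apply: derivableP; exact: ((fC [::] x Ux).2 isT i).
by apply: derivableP; exact: ((fC [:: i] x Ux).2 isT i).
Qed.

Lemma C2_continuous (U : set E) (f : E -> R) : C_on 2 U f ->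
  forall x, U x -> {for x, continuous f}.
Proof. by move=> fC x Ux; exact: ((fC [::] x Ux).1 isT). Qed.

(** The regular level set condition in quantitative form on a cube: m bounds the
derivative of rho in the direction s e_i0 from below, L bounds its gradient and
Lam its Laplacian.  The cube is so small that sg, a bound for rho, satisfies
3 sg Lam <= m^2; then |grad rho|^2 + rho Delta rho >= 2/3 m^2, that is,
Delta (rho^2) >= 4/3 m^2. *)
Definition boundary_chart (Omega : set E) (p : E) (r m Lam L sg s : R) (i0 : 'I_N)
    (rho : E -> R) (D H : 'I_N -> E -> R) : Prop :=
  [/\ [/\ 0 < r, 0 < m, 0 <= L & s ^+ 2 = 1], [/\ 0 <= Lam, 0 < sg & 3 * sg * Lam <= m ^+ 2],
      pjet (cube p r) rho D H,
      forall z, cube p r z -> [/\ {for z, continuous rho}, m <= s * D i0 z,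
        forall i, `|D i z| <= L, `|\sum_i H i z| <= Lam & `|rho z| <= sg] &
      forall z, cube p r z -> (Omega z <-> rho z < 0) /\ (boundary Omega z <-> rho z = 0)].

Lemma near_norm_lt (g : E -> R) (p : E) (t : R) : 0 < t -> {for p, continuous g} ->
  \forall z \near p, `|g z - g p| < t.
Proof.
move=> t0 gc; have /(@cvgrPdist_lt R R E (nbhs p) _ g (g p))/(_ _ t0) := gc.
by apply: filterS => z; rewrite distrC.
Qed.

Lemma boundary_chart_exists (Omega : set E) (p : E) : smooth_boundary Omega ->
  boundary Omega p -> exists r m Lam L sg s i0 rho D H,
  boundary_chart Omega p r m Lam L sg s i0 rho D H.
Proof.
move=> sO bp; have [U [rho [[oU Up] rs g0 h1 h2]]] := sO p bp.
pose D (i : 'I_N) := partial i rho; pose H (i : 'I_N) := partial i (partial i rho).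
have [i0 Di0] : exists i0, D i0 p != 0.
  apply: contrapT => /forallNP h; move/eqP: g0; apply; apply/rowP => i.
  by rewrite !mxE; apply/eqP; have := h i; move/negP; rewrite negbK.
have Dc i : {for p, continuous (D i)} by exact: ((rs 2%N [:: i] p Up).1 isT).
have Hc i : {for p, continuous (H i)} by exact: ((rs 2%N [:: i; i] p Up).1 isT).
have rc := C2_continuous (rs 2%N).
pose s := Num.sg (D i0 p).
have s2 : s ^+ 2 = 1 by rewrite sqr_sg Di0.
pose m := `|D i0 p| / 2.
have m0 : 0 < m by rewrite divr_gt0// normr_gt0.
pose Lam := `|\sum_i H i p| + 1.
have L0 : 0 < Lam by rewrite ltr_wpDl.
pose L := \sum_i `|D i p| + 1.
pose sg := m ^+ 2 / (3 * Lam).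
have sg0 : 0 < sg by rewrite divr_gt0 ?exprn_gt0// mulr_gt0.
have near_s : \forall z \near p, `|s * D i0 z - s * D i0 p| < m.
  by apply: (near_norm_lt (g := fun z => s * D i0 z)) => //; exact: (@cts_scalef R E).
have near_D : \forall z \near p, forall i, `|D i z - D i p| < 1.
  apply: (@filter_forall _ 'I_N (fun i z => `|D i z - D i p| < 1) (nbhs p) _) => i.
  exact: near_norm_lt.
have near_H : \forall z \near p, `|\sum_i H i z - \sum_i H i p| < 1.
  by apply: (near_norm_lt (g := fun z => \sum_i H i z)) => //; exact: (@cts_sumf R E).
have near_r : \forall z \near p, `|rho z - rho p| < sg by apply: near_norm_lt => //; exact: rc.
have near_U : \forall z \near p, U z by exact: open_nbhs_nbhs.
have : \forall z \near p, [/\ U z, `|s * D i0 z - s * D i0 p| < m,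
   (forall i, `|D i z - D i p| < 1), `|\sum_i H i z - \sum_i H i p| < 1 & `|rho z - rho p| < sg].
  by near=> z; split; near: z.
move=> /nbhs_cubeP[r r0 hr].
have rp : rho p = 0 by apply/(h2 p Up).
have sDp : s * D i0 p = 2 * m.
  by rewrite /s -normrEsg /m mulrC divfK.
exists r, m, Lam, L, sg, s, i0, rho, D, H; split.
- by split => //; rewrite addr_ge0// sumr_ge0.
- by split => //; [exact: ltW|rewrite le_eqVlt; apply/orP; left; apply/eqP; rewrite /sg; field; exact: lt0r_neq0].
- by apply: pjet_sub_set (C2_jet (rs 2%N)) => z /hr[].
- move=> z /hr[Uz hs hD hH]; rewrite rp subr0 => hrho; split.
  + exact: rc.
  + by move: hs; rewrite sDp ltr_norml; lra.
  + move=> i; have := hD i; have -> : D i z = (D i z - D i p) + D i p by ring.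
    move=> hDi; apply: (le_trans (ler_normD _ _)).
    have : `|D i p| <= \sum_j `|D j p| by rewrite (bigD1 i)//= lerDl sumr_ge0.
    by rewrite addrK in hDi *; rewrite /L; lra.
  + rewrite -[X in `|X|](subrK (\sum_i H i p)).
    by apply: (le_trans (ler_normD _ _)); rewrite /Lam; lra.
  + exact: ltW.
- by move=> z /hr[Uz _ _ _ _]; split; [exact: h1|exact: h2].
Unshelve. all: end_near. Qed.

(** Along s e_i0 the function rho increases at rate at least m, so it vanishes
before the distance - rho x / m has been travelled. *)
Lemma boundary_point_on_axis (Omega : set E) (p : E) r m Lam L sg s i0 rho D H x :
  boundary_chart Omega p r m Lam L sg s i0 rho D H ->
  Omega x -> cube p (r / 4) x -> - rho x <= m * (r / 4) ->
  exists q, [/\ boundary Omega q, cube p (r / 2) q, cube q (r / 2) x &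
    enorm (x - q) <= - rho x / m].
Proof.
move=> [[r0 m0 L0 s2] _ rj rb rO] Ox px xm.
have px0 : cube p r x by apply: cubeW px; lra.
have rx : rho x < 0 by apply/(rO x px0).1.
pose t1 := - rho x / m.
have t10 : 0 < t1 by rewrite divr_gt0// oppr_gt0.
have t1m : t1 * m = - rho x by rewrite /t1 divfK// lt0r_neq0.
have t1r : t1 <= r / 4 by rewrite /t1 ler_pdivrMr//; lra.
have ns : `|s| = 1.
  have : `|s| ^+ 2 = 1 by rewrite real_normK ?num_real.
  by move/eqP; rewrite sqrp_eq1// => /eqP.
have hc t : 0 <= t <= t1 -> cube x (r / 4) (x + (s * t) *: e_ i0).
  move=> /andP[h1 h2] j; rewrite shift_coordE addrAC subrr add0r !normrM ns mul1r (ger0_norm h1).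
  by case: (j == i0); rewrite ?normr1 ?normr0 ?mul1r ?mul0r//; lra.
have hc2 t : 0 <= t <= t1 -> cube p (r / 2) (x + (s * t) *: e_ i0).
  by move=> /hc h; apply: cubeW (cube_trans px h); lra.
have rr0 : r / 2 <= r by lra.
pose g (t : R) := rho (x + (s * t) *: e_ i0).
have gd t : 0 <= t <= t1 -> is_derive t (1 : R) g (s * D i0 (x + (s * t) *: e_ i0)).
  move=> /hc2 /(cubeW rr0) /rj /(_ i0) [h _].
  have h1 := is_derive_line h.
  have h2 : is_derive t (1 : R) (fun t => s * t) s.
    by apply: (is_derive_eq (is_derive_scalef s (is_derive_id _ _))); rewrite mulr1.
  by apply: (is_derive_eq (is_derive1_comp h1 h2)); rewrite mulrC.
have gc : {within `[0, t1], continuous g}.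
  apply: derivable_within_continuous => t; rewrite in_itv/= => ht.
  by have [] := gd t ht.
have g0 : g 0 = rho x by rewrite /g mulr0 scale0r addr0.
have gt1 : 0 <= g t1.
  have [||t] := @MVT R g (fun t => s * D i0 (x + (s * t) *: e_ i0)) 0 t1 t10.
  - by move=> t; rewrite in_itv/= => /andP[h1 h2]; apply: gd; rewrite !ltW.
  - exact: gc.
  rewrite in_itv/= => /andP[h1 h2]; rewrite g0 subr0 => hg.
  have ht : 0 <= t <= t1 by rewrite !ltW.
  have [_ hm _ _ _] := rb _ (cubeW rr0 (hc2 t ht)).
  have := ler_wpM2r (ltW t10) hm; lra.
have [t] : exists2 t, t \in `[0, t1] & g t = 0.
  apply: IVT => //; first exact: ltW.
  by rewrite g0 ge_min le_max (ltW rx) gt1 orbT.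
rewrite in_itv/= => ht gt.
have [t0 tt1] := andP ht.
exists (x + (s * t) *: e_ i0); split.
- by apply/(rO _ (cubeW rr0 (hc2 t ht))).2.
- exact: hc2.
- by apply: cube_sym; apply: cubeW (hc t ht); lra.
apply: le_trans tt1; apply: le_trans (enorm_le_sum _) _.
pose q : E := x + (s * t) *: e_ i0.
rewrite -/q; have hj j : `|(x - q) 0 j| = (j == i0)%:R * t.
  rewrite mxE [(- q) 0 j]mxE /q shift_coordE opprD addrA subrr add0r normrN !normrM ns mul1r (ger0_norm t0).
  by case: (j == i0); rewrite ?normr1 ?normr0.
rewrite (bigD1 i0)//= hj eqxx mul1r big1 ?addr0// => j /negPf ji.
by rewrite hj ji mul0r.
Qed.

(** This is the comparison on the side faces in the lower bound, where w is - rho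
and v the eigenfunction.  Close to the boundary the barrier itself is below e r;
away from it the eigenfunction is at least mu, and e is chosen accordingly. *)
Lemma lower_barrier_side (v w sg b e tau mu r : R) : 0 < e -> 0 <= b -> 0 <= w <= sg ->
  0 <= v -> 0 <= r -> tau * (1 + b * sg) = r -> e * (sg * (1 + b * sg)) = mu ->
  (tau < w -> mu <= v) -> e * (w + b * (w * w)) <= e * r + v.
Proof.
move=> e0 b0 /andP[w0 wsg] v0 r0 tE mE hv.
have c0 : 0 <= 1 + b * sg by rewrite addr_ge0// mulr_ge0// (le_trans w0).
have h : e * (w + b * (w * w)) <= e * (w * (1 + b * sg)).
  have hb : b * (w * w) <= b * (w * sg) by rewrite ler_wpM2l// ler_wpM2l.
  by rewrite ler_wpM2l ?(ltW e0)//; lra.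
apply: (le_trans h); have [wt|tw] := leP w tau.
  rewrite ler_wpDr// -tE ler_wpM2l ?(ltW e0)//; exact: ler_wpM2r.
apply: (@le_trans _ _ mu); first by rewrite -mE ler_wpM2l ?(ltW e0)//; exact: ler_wpM2r.
by rewrite (le_trans (hv tw))// lerDr mulr_ge0// ltW.
Qed.

End SmoothClass.

(** * Barriers for the eigenfunction *)

Section Barriers.
Context {R : realType} {N : nat}.
Local Notation E := 'rV[R]_N.
Local Notation e_ i := (delta_mx (0 : 'I_1) i : E).
Variable Omega : set E.
Hypothesis N0 : (0 < N)%N.
Hypothesis oOmega : open Omega.
Hypothesis bOmega : bounded_set Omega.
Hypothesis nOmega : Omega !=set0.
Variables (phi : E -> R) (lam : R).
Hypothesis phic : {within closure Omega, continuous phi}.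
Hypothesis phiC : C_on 2 Omega phi.
Hypothesis phi_eq : forall x, Omega x -> - laplacian phi x = lam * phi x.
Hypothesis phi_bd : forall x, boundary Omega x -> phi x = 0.
Hypothesis phi_gt0 : forall x, Omega x -> 0 < phi x.
Local Notation d := (bdist Omega).
Implicit Types (x y z p q : E).

(** The squared Euclidean distance to q, in the form for which the pure second
derivatives are available. *)
Definition sqdist q : E -> R := quadratic (fun=> 1) (fun=> 0) q.

Lemma sqdistE q x : sqdist q x = enorm (x - q) ^+ 2.
Proof. by rewrite sqr_enorm; apply: eq_bigr => i _; rewrite !mxE; ring. Qed.

(** Otherwise phi would be strictly subharmonic, hence nonpositive by the
maximum principle. *)
Lemma eigenvalue_ge0 : 0 <= lam.
Proof.
rewrite leNgt; apply/negP => l0; have [x Ox] := nOmega.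
have := @max_principle R N (closure Omega) Omega phi _ _ (compact_closure bOmega) oOmega
  (@subset_closure _ _) phic (C2_jet phiC).
have Hp y : Omega y -> 0 < \sum_i partial i (partial i phi) y.
  move=> Oy; have := phi_eq Oy; rewrite /laplacian => h.
  by have := phi_gt0 Oy; nra.
move=> /(_ Hp) H; have : phi x <= 0.
  apply: H => [y cy nOy|]; last exact: subset_closure.
  by rewrite phi_bd// (boundaryE oOmega).
by rewrite leNgt phi_gt0.
Qed.

Lemma within_add (A : set E) (f g : E -> R) : {within A, continuous f} ->
  {within A, continuous g} -> {within A, continuous (fun x => f x + g x)}.
Proof. by move=> fc gc x; exact: (cvgD (fc x) (gc x)). Qed.

Lemma within_scale (A : set E) c (f : E -> R) : {within A, continuous f} ->
  {within A, continuous (fun x => c * f x)}.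
Proof. by move=> fc x; exact: (cvgMl_tmp (fc x)). Qed.

Lemma within_pointwise (A : set E) (f : E -> R) : (forall x, A x -> {for x, continuous f}) ->
  {within A, continuous f}.
Proof. by move=> fc; apply: continuous_in_subspaceT => x; rewrite inE; exact: fc. Qed.

(** The maximum principle for c phi + A rho + B rho^2 - kap |x - q|^2 on the
part of Omega in a cube about q.  The Laplacian of B rho^2 is at least 4/3 B m^2
and dominates the other terms; rho and phi vanish on the boundary of Omega; on the
side faces |x - q| >= r, which is where the last hypothesis enters.  The
upper bound for phi uses c = 1 and the lower bound c = -1. *)
Lemma barrier_comparison p r0 m Lam L sg s i0 rho D H q r c A B kap :
  boundary_chart Omega p r0 m Lam L sg s i0 rho D H ->
  0 < r -> cube q r `<=` cube p r0 -> 0 <= B -> 0 <= kap ->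
  (forall x, Omega x -> `|A| * Lam + 2 * N%:R * kap + c * lam * phi x < 4 / 3 * B * m ^+ 2) ->
  (forall x, Omega x -> cube q r x ->
     c * phi x + (A * rho x + B * (rho x * rho x)) <= kap * r ^+ 2) ->
  forall x, Omega x -> cube q r x ->
  c * phi x + (A * rho x + B * (rho x * rho x)) <= kap * sqdist q x.
Proof.
move=> [[r00 m0 L0 s2] [Lam0 sg0 hsg] rj rb rO] rpos sub B0 k0 hlap hside x Ox xq.
pose U := Omega `&` ball q r.
pose K := closure Omega `&` cube q r.
have Uq y : U y -> cube q r y.
  by move=> [_ [_ h]] j; rewrite distrC; exact/ltW/(h 0 j).
have phij : pjet U phi _ _ := pjet_sub_set (@subIsetl _ _ _) (C2_jet phiC).
have rhoj : pjet U rho _ _ := pjet_sub_set (fun y Uy => sub y (Uq y Uy)) rj.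
have fj := pjet_add (pjet_scale c phij) (pjet_add (pjet_add (pjet_scale A rhoj)
  (pjet_scale B (pjet_sq rhoj))) (pjet_scale (- kap) (@pjet_quadratic R N U (fun=> 1) (fun=> 0) q))).
have sq0 y : 0 <= sqdist q y by rewrite sqdistE sqr_ge0.
suff : c * phi x + (A * rho x + B * (rho x * rho x) + - kap * sqdist q x) <= 0 by lra.
apply: (@max_principle R N K U (fun x => c * phi x + (A * rho x + B * (rho x * rho x) + - kap * sqdist q x))
   _ _ _ _ _ _ fj).
- by apply: compact_closedI; [exact: compact_closure|exact: cube_closed].
- by apply: openI => //; exact: ball_open.
- by move=> y Uy; split; [exact/subset_closure/Uy.1|exact: Uq].
- have cr : {within K, continuous rho}.
    by apply: within_pointwise => y [_ /sub /rb[]].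
  apply: within_add; first by apply: within_scale; apply: continuous_subspaceW phic; exact: subIsetl.
  apply: within_add; last first.
    by apply: within_scale; apply: continuous_subspaceT; exact: continuous_quadratic.
  apply: within_add; apply: within_scale => //.
  by move=> y; exact: (cvgM (cr y) (cr y)).
- move=> y Uy; have Oy : Omega y := Uy.1.
  rewrite !big_split/= -!mulr_sumr !big_split/= -!mulr_sumr.
  have := phi_eq Oy; rewrite /laplacian => hphi.
  have [_ hm _ hH hr] := rb y (sub y (Uq y Uy)).
  have g2 : m ^+ 2 <= \sum_i D i y * D i y.
    rewrite (bigD1 i0)//= ler_wpDr//.
      by apply: sumr_ge0 => j _; rewrite -expr2 sqr_ge0.
    have -> : D i0 y * D i0 y = (s * D i0 y) ^+ 2 by rewrite exprMn s2 mul1r expr2.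
    by rewrite ler_sqr ?nnegrE ?(ltW m0)// (le_trans (ltW m0)).
  have hq : `|rho y * \sum_i H i y| <= sg * Lam by rewrite normrM ler_pM.
  have hA : `|A * \sum_i H i y| <= `|A| * Lam by rewrite normrM ler_wpM2l.
  rewrite sumr_const card_ord -mulr_natl mulr1.
  have := hlap y Oy.
  move: hq hA; rewrite !ler_norml => /andP[hq1 hq2] /andP[hA1 hA2].
  have hB : B * (m ^+ 2 - sg * Lam) <= B * (\sum_i D i y * D i y + rho y * \sum_i H i y).
    by rewrite ler_wpM2l//; lra.
  have hB2 : 2 / 3 * (B * m ^+ 2) <= B * (m ^+ 2 - sg * Lam).
    have : 0 <= B * (m ^+ 2 - 3 * sg * Lam) by rewrite mulr_ge0// subr_ge0.
    lra.
  have -> : \sum_i partial i (partial i phi) y = - (lam * phi y) by lra.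
  lra.
- move=> y [cy qy] nU.
  (* a point on the boundary of Omega: phi and rho vanish *)
  have [Oy|nOy] := pselect (Omega y); last first.
    have by_ : boundary Omega y by rewrite (boundaryE oOmega).
    have r_0 : rho y = 0 by apply/(rO y (sub y qy)).2.
    rewrite phi_bd// r_0 !mulr0 !add0r mulNr oppr_le0 mulr_ge0//.
  (* a point of Omega on a side face of the cube *)
  have hs : r ^+ 2 <= sqdist q y.
    have [j hj] : exists j, ~ `|y 0 j - q 0 j| < r.
      apply: contrapT => /forallNP hn; apply: nU; split => //; split => // i j.
      rewrite ord1 /ball/= distrC; apply: contrapT; exact: hn.
    rewrite sqdistE sqr_enorm (bigD1 j)//= !mxE ler_wpDr//.
      by apply: sumr_ge0 => k _; exact: sqr_ge0.
    rewrite -[leRHS]real_normK ?num_real// ler_sqr ?nnegrE ?normr_ge0 ?(ltW rpos)//.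
    by rewrite leNgt; apply/negP.
  have := hside y Oy qy.
  have : kap * r ^+ 2 <= kap * sqdist q y by rewrite ler_wpM2l.
  lra.
- by split; [exact: subset_closure|].
Qed.

Lemma eigenfunction_bounded : exists2 M, 0 < M & forall x, Omega x -> phi x <= M.
Proof.
have [_ [C hC]] := C_closure_bdd_continuous oOmega bOmega phic.
exists (`|C| + 1) => [|x Ox]; first by rewrite ltr_wpDl.
apply: (le_trans (ler_norm _)); apply: (le_trans (hC x Ox)).
by rewrite (le_trans (ler_norm C))// lerDl.
Qed.

(** The comparison is applied with c = 1 and a boundary point q closer than
2 d x.  Then |x - q|^2 is at most a constant times d x, and so is - rho x, since
rho vanishes at q. *)
Lemma eigenfunction_le_dist_near p : smooth_boundary Omega -> boundary Omega p ->
  exists r C, [/\ 0 < r, 0 < C & forall x, Omega x -> cube p r x -> phi x <= C * d x].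
Proof.
move=> sO bp.
have [r0 [m [Lam [L [sg [s [i0 [rho [D [H ch]]]]]]]]]] := boundary_chart_exists sO bp.
have [[r00 m0 L0 s2] [Lam0 sg0 hsg] rj rb rO] := ch.
have [M M0 hM] := eigenfunction_bounded.
have l0 := eigenvalue_ge0.
pose r := r0 / 2.
have rpos : 0 < r by rewrite /r; lra.
pose kap := M / r ^+ 2.
have k0 : 0 < kap by rewrite divr_gt0// exprn_gt0.
have Nge0 : 0 <= N%:R :> R by [].
pose B := (2 * N%:R * kap + lam * M + 1) / m ^+ 2.
have lM : 0 <= lam * M by rewrite mulr_ge0// ltW.
have Nk : 0 <= 2 * N%:R * kap by apply: mulr_ge0 (ltW k0); apply: mulr_ge0.
have B0 : 0 < B by rewrite divr_gt0 ?exprn_gt0//; lra.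
have Bm : B * m ^+ 2 = 2 * N%:R * kap + lam * M + 1.
  by rewrite /B divfK// expf_neq0// lt0r_neq0.
pose A := B * sg.
have A0 : 0 < A by rewrite mulr_gt0.
pose r' := r / (2 * N%:R + 1).
have c0 : 0 < 2 * N%:R + 1 :> R by lra.
have r'0 : 0 < r' by rewrite divr_gt0.
have r'r : (2 * N%:R + 1) * r' = r by rewrite /r' mulrC divfK// lt0r_neq0.
exists r', (4 * kap * (N%:R * r') + 2 * A * L * N%:R + 1); split => //.
  have h1 : 0 <= 4 * kap * (N%:R * r').
    by apply: mulr_ge0; apply: mulr_ge0 => //; exact: ltW.
  have h2 : 0 <= 2 * A * L * N%:R.
    by apply: mulr_ge0 => //; apply: mulr_ge0 => //; apply: mulr_ge0 => //; exact: ltW.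
  lra.
move=> x Ox px.
have dx0 : 0 < d x by exact: bdist_gt0.
have dN : d x <= N%:R * r' := le_trans (bdist_le N0 oOmega bOmega nOmega x bp) (enorm_cube px).
have [q bq xq] : exists2 q, boundary Omega q & enorm (x - q) < 2 * d x.
  by apply: bdist_approx => //; lra.
have xqj j : `|x 0 j - q 0 j| <= 2 * d x.
  have := coord_le_enorm (x - q) j; rewrite !mxE => h; exact: (le_trans h (ltW xq)).
have qx : cube q r x.
  by move=> j; apply: (le_trans (xqj j)); lra.
have pq : cube p r q.
  have h : cube x (2 * d x) q by move=> j; rewrite distrC; exact: xqj.
  by apply: cubeW (cube_trans px h); lra.
have sub : cube q r `<=` cube p r0.
  by move=> z qz; apply: (cubeW (r := r + r)); [rewrite /r; lra|exact: cube_trans pq qz].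
have := barrier_comparison (c := 1) (A := A) (B := B) (kap := kap) ch rpos sub (ltW B0) (ltW k0).
move=> /(_ _ _ _ Ox qx) => bc.
have {}bc : 1 * phi x + (A * rho x + B * (rho x * rho x)) <= kap * sqdist q x.
  apply: bc => y Oy.
    have : lam * phi y <= lam * M by rewrite ler_wpM2l// hM.
    have : B * (3 * sg * Lam) <= B * m ^+ 2 by rewrite ler_wpM2l// ltW.
    by rewrite (gtr0_norm A0) /A; lra.
  move=> qy; have [_ _ _ _ hr] := rb y (sub y qy).
  have ry : rho y < 0 by apply/(rO y (sub y qy)).1.
  rewrite /kap divfK ?expf_neq0 ?lt0r_neq0// mul1r.
  have : 0 <= B * ((sg + rho y) * - rho y).
    move: hr; rewrite ler_norml => /andP[hr _].
    by apply: mulr_ge0 (ltW B0) _; apply: mulr_ge0; lra.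
  by have := hM y Oy; rewrite /A; lra.
have hrho : `|rho x| <= L * (N%:R * (2 * d x)).
  have rq : rho q = 0 by apply/(rO q _).2 => //; apply: cubeW pq; rewrite /r; lra.
  have := @coord_mvt R N rho D (fun=> 0) (fun=> L) q r (fun z qz i => (rj z (sub z qz) i).1) _ x qx.
  have -> : \sum_i 0 * (x 0 i - q 0 i) = 0 by rewrite big1// => i _; rewrite mul0r.
  rewrite rq !subr0 => h; apply: (le_trans (h _)) => [z qz i|].
    by rewrite subr0; have [_ _ hL _ _] := rb z (sub z qz).
  rewrite -mulr_sumr ler_wpM2l//.
  apply: (@le_trans _ _ (\sum_(i < N) (2 * d x))); first exact: ler_sum.
  by rewrite sumr_const card_ord [leRHS]mulr_natl.
have hQ : sqdist q x <= 4 * (N%:R * r') * d x.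
  rewrite sqdistE expr2; apply: (@le_trans _ _ ((2 * d x) * (2 * d x))).
    by rewrite ler_pM ?enorm_ge0// ltW.
  have := ler_wpM2r (ltW dx0) dN; lra.
have h1 : kap * sqdist q x <= kap * (4 * (N%:R * r') * d x) by rewrite ler_wpM2l// ltW.
have h2 : A * - rho x <= A * (L * (N%:R * (2 * d x))).
  rewrite ler_wpM2l ?(ltW A0)//; apply: le_trans hrho.
  by rewrite -normrN ler_norm.
have h3 : 0 <= B * (rho x * rho x) by rewrite mulr_ge0 ?(ltW B0)// -expr2 sqr_ge0.
lra.
Qed.

(** Compactness, applied to phi + 2 max (rho + tau, 0): this function is
positive also at boundary points, where phi and rho vanish, and equals phi where
rho <= - tau. *)
Lemma positive_away_from_zero_set (p : E) (r0 : R) (rho : E -> R) (tau : R) : 0 < tau -> 0 <= r0 ->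
  boundary Omega p ->
  (forall z, cube p r0 z -> {for z, continuous rho} /\ (boundary Omega z -> rho z = 0)) ->
  exists2 mu, 0 < mu & forall x, Omega x -> cube p r0 x -> rho x <= - tau -> mu <= phi x.
Proof.
move=> t0 r00 bp hr.
pose K := closure Omega `&` cube p r0.
pose F x := phi x + (`|rho x + tau| + (rho x + tau)).
have cK : compact K by apply: compact_closedI; [exact: compact_closure|exact: cube_closed].
have cr : {within K, continuous (fun x => rho x + tau)}.
  apply: within_pointwise => z [_ /hr[h _]].
  by apply: (@cts_addf R E) => //; exact: cts_cstf.
have cF : {within K, continuous F}.
  apply: within_add; first by apply: continuous_subspaceW phic; exact: subIsetl.
  by apply: within_add => // z; exact: (cvg_norm (cr z)).
have [|z zK zmin] := @compact_EVT_min _ R F K _ cK cF.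
  by exists p; split; [rewrite (boundaryE oOmega) in bp; exact: bp.1|exact: cube_center].
rewrite inE in zK.
exists (F z) => [|x Ox px hx].
  have h0 : 0 <= `|rho z + tau| + (rho z + tau).
    by have := ler_norm (- (rho z + tau)); rewrite normrN; lra.
  have [Oz|nOz] := pselect (Omega z); first by rewrite /F ltr_pwDl// phi_gt0.
  have bz : boundary Omega z by rewrite (boundaryE oOmega); split => //; exact: zK.1.
  by rewrite /F phi_bd// (hr z zK.2).2// !add0r gtr0_norm// addr_gt0.
have xK : K x by split => //; exact: subset_closure.
have := zmin x (mem_set xK); rewrite {2}/F ler0_norm; last by lra.
by rewrite addNr addr0.
Qed.

(** The bound of Hopf.  The comparison is applied with c = -1 and the point q
found by moving from x along a coordinate axis.  As |x - q| <= - rho x / m is small,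
the quadratic term costs only half of the barrier, which leaves
phi x >= e (- rho x) / 2; and - rho x is at least m times d x. *)
Lemma dist_le_eigenfunction_near p : smooth_boundary Omega -> boundary Omega p ->
  exists r c, [/\ 0 < r, 0 < c & forall x, Omega x -> cube p r x -> c * d x <= phi x].
Proof.
move=> sO bp.
have [r0 [m [Lam [L [sg [s [i0 [rho [D [H ch]]]]]]]]]] := boundary_chart_exists sO bp.
have [[r00 m0 L0 s2] [Lam0 sg0 hsg] rj rb rO] := ch.
have l0 := eigenvalue_ge0.
pose r := r0 / 2.
have rpos : 0 < r by rewrite /r; lra.
have Nge0 : 0 <= N%:R :> R by [].
pose b := (Lam + 2 * N%:R + 1) / m ^+ 2.
have b0 : 0 < b by rewrite divr_gt0 ?exprn_gt0//; lra.
have bm : b * m ^+ 2 = Lam + 2 * N%:R + 1.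
  by rewrite /b divfK// expf_neq0// lt0r_neq0.
have c0 : 0 < 1 + b * sg by rewrite addr_gt0// mulr_gt0.
pose tau := r ^+ 2 / (1 + b * sg).
have tau0 : 0 < tau by rewrite divr_gt0// exprn_gt0.
have tauE : tau * (1 + b * sg) = r ^+ 2 by rewrite /tau divfK// lt0r_neq0.
have [mu mu0 hmu] : exists2 mu, 0 < mu &
    forall x, Omega x -> cube p r0 x -> rho x <= - tau -> mu <= phi x.
  apply: positive_away_from_zero_set => //; first exact: ltW.
  by move=> z pz; split; [have [] := rb z pz|move=> /((rO z pz).2)].
have sgb : 0 < sg * (1 + b * sg) by rewrite mulr_gt0.
pose e := mu / (sg * (1 + b * sg)).
have e0 : 0 < e by rewrite divr_gt0.
have eE : e * (sg * (1 + b * sg)) = mu by rewrite /e divfK// lt0r_neq0.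
(* The first bound keeps the boundary point found from x inside the chart, the
   second makes |x - q|^2 at most half of - rho x. *)
pose eta := Num.min (m * (r0 / 4)) (m ^+ 2 / 2).
have eta0 : 0 < eta by rewrite lt_min mulr_gt0 ?divr_gt0 ?exprn_gt0//; lra.
have eta1 : eta <= m * (r0 / 4) by rewrite ge_min lexx.
have eta2 : eta <= m ^+ 2 / 2 by rewrite ge_min lexx orbT.
have pp : cube p r0 p by exact: cube_center (ltW r00).
have rhop : rho p = 0 by apply/(rO p pp).2.
have [r1 r10 hr1] : exists2 r1 : R, 0 < r1 & cube p r1 `<=` [set z | `|rho z| < eta].
  apply: nbhs_cubeP; have [rc _ _ _ _] := rb p pp.
  have := near_norm_lt eta0 rc; rewrite rhop.
  by apply: filterS => z; rewrite subr0.
pose r' := Num.min r1 (r0 / 4).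
have r'0 : 0 < r' by rewrite lt_min r10; lra.
have r'1 : r' <= r1 by rewrite ge_min lexx.
have r'2 : r' <= r0 / 4 by rewrite ge_min lexx orbT.
exists r', (e * m / 2); split => //; first by rewrite divr_gt0// mulr_gt0.
move=> x Ox px.
have px0 : cube p r0 x by apply: cubeW px; lra.
have rx : rho x < 0 by apply/(rO x px0).1.
have rxe : - rho x < eta by have := hr1 x (cubeW r'1 px); rewrite /= ltr0_norm.
pose t1 := - rho x / m.
have t10 : 0 < t1 by rewrite divr_gt0// oppr_gt0.
have t1m : t1 * m = - rho x by rewrite /t1 divfK// lt0r_neq0.
have [q [bq pq qx dist]] : exists q, [/\ boundary Omega q, cube p r q, cube q r x &
    enorm (x - q) <= t1].
  apply: (boundary_point_on_axis ch Ox); first by apply: cubeW px; lra.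
  exact: le_trans (ltW rxe) eta1.
have sub : cube q r `<=` cube p r0.
  by move=> z qz; apply: (cubeW (r := r + r)); [rewrite /r; lra|exact: cube_trans pq qz].
have := barrier_comparison (c := -1) (A := - e) (B := e * b) (kap := e) ch rpos sub
  (mulr_ge0 (ltW e0) (ltW b0)) (ltW e0).
move=> /(_ _ _ _ Ox qx) => bc.
have {}bc : -1 * phi x + (- e * rho x + e * b * (rho x * rho x)) <= e * sqdist q x.
  apply: bc => y Oy.
    have : 0 <= lam * phi y by rewrite mulr_ge0// ltW// phi_gt0.
    have := mulr_gt0 e0 ltr01; have : 0 <= e * (Lam + 2 * N%:R).
      by rewrite mulr_ge0 ?(ltW e0)//; lra.
    have -> : 4 / 3 * (e * b) * m ^+ 2 = 4 / 3 * e * (Lam + 2 * N%:R + 1) by rewrite -bm; ring.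
    by rewrite normrN (gtr0_norm e0); lra.
  move=> qy; have [_ _ _ _ hr] := rb y (sub y qy).
  have ry : rho y < 0 by apply/(rO y (sub y qy)).1.
  have ry2 : 0 <= - rho y <= sg by rewrite oppr_ge0 (ltW ry) -(ltr0_norm ry).
  have := lower_barrier_side e0 (ltW b0) ry2 (ltW (phi_gt0 Oy)) (sqr_ge0 r) tauE eE.
  have h : tau < - rho y -> mu <= phi y.
    by move=> ht; apply: hmu => //; [exact: sub|rewrite lerNr ltW].
  move=> /(_ h); rewrite mulrNN mulN1r; set w := rho y * rho y.
  clear -R; move: (phi y) (e * r ^+ 2) (rho y) => v c w'; lra.
have hQ : sqdist q x <= t1 * t1 by rewrite sqdistE expr2 ler_pM ?enorm_ge0.
have hd : d x <= t1 := le_trans (bdist_le N0 oOmega bOmega nOmega x bq) dist.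
have ht1 : t1 * t1 <= - rho x / 2.
  have t1h : t1 <= m / 2.
    rewrite -(ler_pM2r m0) t1m; apply: (le_trans (ltW rxe)); apply: (le_trans eta2).
    by rewrite expr2 mulrAC.
  by have := ler_wpM2l (ltW t10) t1h; rewrite (mulrA t1 m) t1m.
have hQ2 : e * sqdist q x <= e * (- rho x / 2).
  by rewrite ler_wpM2l ?(ltW e0)//; exact: le_trans hQ ht1.
have h3 : 0 <= e * b * (rho x * rho x).
  by apply: mulr_ge0; [exact: ltW (mulr_gt0 e0 b0)|rewrite -expr2 sqr_ge0].
have h4 : e * m / 2 * d x <= e * m / 2 * t1.
  by rewrite ler_wpM2l// divr_ge0// mulr_ge0// ltW.
have h5 : e * m / 2 * t1 = e * (- rho x) / 2 by rewrite -t1m; ring.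
lra.
Qed.

End Barriers.

(** * Comparability with powers of the distance *)

Section PowerComparison.
Context {R : realType}.
Implicit Types (a b c K L r : R).

(** Two-sided comparability: unlike a one-sided bound it survives raising to a
power of either sign. *)
Definition within_factor K a b : Prop := a <= K * b /\ b <= K * a.

Lemma within_factor_trans K L a b c : 0 <= K -> 0 <= L ->
  within_factor K a b -> within_factor L b c -> within_factor (K * L) a c.
Proof.
move=> K0 L0 [ab ba] [bc cb]; split.
  by apply: le_trans ab _; rewrite -mulrA ler_wpM2l.
by apply: le_trans cb _; rewrite (mulrC K) -mulrA ler_wpM2l.
Qed.

Lemma within_factor_powR K a b r : 0 < K -> 0 < a -> 0 < b ->
  within_factor K a b -> within_factor (K `^ `|r|) (a `^ r) (b `^ r).
Proof.
move=> K0 a0 b0 [ab ba].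
have lab : ln a <= ln K + ln b by rewrite -lnM ?posrE// ler_ln ?posrE// mulr_gt0.
have lba : ln b <= ln K + ln a by rewrite -lnM ?posrE// ler_ln ?posrE// mulr_gt0.
have hl : `|r * (ln a - ln b)| <= `|r| * ln K.
  by rewrite normrM ler_wpM2l// ler_norml; lra.
move: hl; rewrite ler_norml => /andP[h1 h2].
by split; rewrite /powR !gt_eqF// -expRD ler_expR; lra.
Qed.

Lemma continuous_powR a r : 0 < a -> {for a, continuous (fun t : R => t `^ r)}.
Proof.
move=> a0; apply: differentiable_continuous; apply/derivable1_diffP.
by apply: derivable_powR; rewrite in_itv/= a0.
Qed.

Lemma powR_subK a r : 0 < a -> a `^ (r - 1) * a = a `^ r.
Proof. move=> a0; rewrite -[X in _ * X]powRr1 ?ltW// -powRD ?subrK//.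
by apply/implyP => _; rewrite gt_eqF. Qed.

End PowerComparison.

Section DistanceComparison.
Context {R : realType} {N : nat}.
Local Notation E := 'rV[R]_N.
Variable Omega : set E.
Hypothesis N0 : (0 < N)%N.
Hypothesis oOmega : open Omega.
Hypothesis bOmega : bounded_set Omega.
Hypothesis nOmega : Omega !=set0.
Local Notation d := (bdist Omega).

(** The comparison holds near each point of the closure, by the two barriers
at the boundary and by continuity and positivity inside, and weakens as the
constant decreases, so compactness yields a uniform constant. *)
Lemma eigenfunction_comparable_dist (phi : E -> R) (lam : R) : smooth_boundary Omega ->
  dirichlet_eigenpair Omega lam phi -> (forall x, Omega x -> 0 < phi x) ->
  exists2 K, 0 < K & forall x, Omega x -> within_factor K (phi x) (d x).
Proof.
move=> sO [phic phiC _ phi_eq phi_bd] phi_gt0.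
pose P e x := Omega x -> e * d x <= phi x /\ e * phi x <= d x.
suff : \forall e \near (0 : R)^'+, closure Omega `<=` P e.
  move=> h; have [e [e0 he]] : exists e : R, 0 < e /\ closure Omega `<=` P e.
    apply: (@filter_ex _ ((0 : R)^'+)); near=> e; split; near: e => //.
    exact: nbhs_right_gt.
  exists e^-1; first by rewrite invr_gt0.
  move=> x Ox; have [h1 h2] := he x (subset_closure Ox) Ox.
  by split; rewrite mulrC ler_pdivlMr// mulrC.
suff hloc y : closure Omega y -> exists r e, [/\ 0 < r, 0 < e &
    forall x, Omega x -> cube y r x -> e * d x <= phi x /\ e * phi x <= d x].
  have /compact_near_coveringP := compact_closure bOmega.
  move=> /(_ _ _ P (at_right_proper_filter (0 : R))); apply => y /hloc[r [e [r0 e0 he]]].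
  exists (cube y r, [set t : R | 0 < t <= e]) => /=.
    split; first exact: nbhs_cube.
    near=> t; apply/andP; split; near: t; [exact: nbhs_right_gt|exact: nbhs_right_le].
  move=> [x t] [/= yx /andP[t0 te]] Ox; have [h1 h2] := he x Ox yx.
  have dx := bdist_gt0 N0 oOmega bOmega nOmega Ox; have px := phi_gt0 x Ox.
  by split; [apply: le_trans h1|apply: le_trans h2]; rewrite ler_wpM2r// ltW.
move=> cy; have [Oy|nOy] := pselect (Omega y).
  have dy := bdist_gt0 N0 oOmega bOmega nOmega Oy; have py := phi_gt0 y Oy.
  have dy2 : 0 < d y / 2 by rewrite divr_gt0.
  have py2 : 0 < phi y / 2 by rewrite divr_gt0.
  have hd := near_norm_lt dy2 (continuous_bdist N0 oOmega bOmega nOmega (x := y)).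
  have hp := near_norm_lt py2 (C2_continuous phiC Oy).
  have : \forall x \near y, `|d x - d y| < d y / 2 /\ `|phi x - phi y| < phi y / 2.
    by near=> x; split; near: x.
  move=> /nbhs_cubeP[r r0 hr].
  pose e := Num.min (phi y / (4 * d y)) (d y / (4 * phi y)).
  have e0 : 0 < e by rewrite lt_min !divr_gt0// mulr_gt0.
  have e1 : e * d y <= phi y / 4.
    have : e <= phi y / (4 * d y) by rewrite ge_min lexx.
    move=> /(ler_wpM2r (ltW dy)) h; apply: le_trans h _; rewrite le_eqVlt; apply/orP; left.
    by apply/eqP; field; rewrite gt_eqF.
  have e2 : e * phi y <= d y / 4.
    have : e <= d y / (4 * phi y) by rewrite ge_min lexx orbT.
    move=> /(ler_wpM2r (ltW py)) h; apply: le_trans h _; rewrite le_eqVlt; apply/orP; left.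
    by apply/eqP; field; rewrite gt_eqF.
  exists r, e; split => // x Ox /hr[]; rewrite !ltr_norml => /andP[d1 d2] /andP[p1 p2]; split.
    apply: (@le_trans _ _ (e * (2 * d y))); last lra.
    by rewrite ler_wpM2l ?(ltW e0)//; lra.
  apply: (@le_trans _ _ (e * (2 * phi y))); last lra.
  by rewrite ler_wpM2l ?(ltW e0)//; lra.
have by_ : boundary Omega y by rewrite (boundaryE oOmega).
have [r1 [C [r10 C0 h1]]] := eigenfunction_le_dist_near N0 oOmega bOmega nOmega
  phic phiC phi_eq phi_bd phi_gt0 sO by_.
have [r2 [c [r20 c0 h2]]] := dist_le_eigenfunction_near N0 oOmega bOmega nOmega
  phic phiC phi_eq phi_bd phi_gt0 sO by_.
exists (Num.min r1 r2), (Num.min c C^-1); split; rewrite ?lt_min ?r10 ?c0 ?invr_gt0//.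
move=> x Ox yx; have px := phi_gt0 x Ox.
have dx := bdist_gt0 N0 oOmega bOmega nOmega Ox.
have yx1 : cube y r1 x by apply: cubeW yx; rewrite ge_min lexx.
have yx2 : cube y r2 x by apply: cubeW yx; rewrite ge_min lexx orbT.
split.
  by apply: le_trans (h2 x Ox yx2); rewrite ler_wpM2r ?(ltW dx)// ge_min lexx.
apply: (@le_trans _ _ (C^-1 * phi x)).
  by rewrite ler_wpM2r ?(ltW px)// ge_min lexx orbT.
by rewrite mulrC ler_pdivrMr// mulrC; exact: h1.
Unshelve. all: end_near. Qed.

Lemma dist_comparable_cube x s y : 0 < s -> N%:R * s <= d x / 2 -> cube x s y ->
  within_factor 2 (d y) (d x).
Proof.
move=> s0 hs xy; have h1 := enorm_cube xy.
have h2 := bdist_lipschitz N0 oOmega bOmega nOmega x y.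
have h3 := bdist_lipschitz N0 oOmega bOmega nOmega y x.
rewrite enorm_dist in h3.
by split; lra.
Qed.

(** The defining inequalities hold almost everywhere between continuous
functions, hence everywhere. *)
Lemma Cplus_comparable (g : R) (phi u : E -> R) (K : R) : 0 < K ->
  (forall x, Omega x -> 0 < phi x) -> (forall x, Omega x -> {for x, continuous phi}) ->
  (forall x, Omega x -> within_factor K (phi x) (d x)) ->
  Cplus Omega (fun x => phi x `^ g) u ->
  exists2 L, 0 < L & forall x, Omega x -> within_factor L (u x) (d x `^ g).
Proof.
move=> K0 phi_gt0 phic hK [uc [c1 [c2 [c10 c20 hae]]]].
have ur := (C_closure_bdd_continuous oOmega bOmega uc).1.
have phigc c x : Omega x -> {for x, continuous (fun x => c * phi x `^ g)}.
  move=> Ox; apply: (@cts_scalef R E).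
  by apply: (@continuous_comp E R R phi (fun t => t `^ g)); [exact: phic|exact/continuous_powR/phi_gt0].
have hae1 : ae_in Omega (fun x => c1 * phi x `^ g <= u x).
  by move: hae; rewrite /ae_in; apply: filterS => t h Ot; case/andP: (h Ot).
have hae2 : ae_in Omega (fun x => u x <= c2 * phi x `^ g).
  by move: hae; rewrite /ae_in; apply: filterS => t h Ot; case/andP: (h Ot).
have hlow := ae_in_everywhere oOmega (phigc c1) ur hae1.
have hup := ae_in_everywhere oOmega ur (phigc c2) hae2.
have KP : 0 < K `^ `|g| by exact: powR_gt0.
have C0 : 0 < c2 + c1^-1 by rewrite addr_gt0// invr_gt0.
exists ((c2 + c1^-1) * K `^ `|g|); first exact: mulr_gt0.
move=> x Ox; apply: (within_factor_trans (b := phi x `^ g) (ltW C0) (ltW KP)); last first.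
  apply: within_factor_powR => //; [exact: phi_gt0|exact: bdist_gt0|exact: hK].
have pg : 0 < phi x `^ g by exact/powR_gt0/phi_gt0.
have l := hlow x Ox; have up := hup x Ox.
have u0 : 0 < u x by apply: lt_le_trans l; exact: mulr_gt0.
have ci : 0 < c1^-1 by rewrite invr_gt0.
split; first by apply: le_trans up _; rewrite ler_wpM2r ?(ltW pg)// lerDl ltW.
apply: (@le_trans _ _ (c1^-1 * u x)).
  by rewrite mulrC ler_pdivlMr// mulrC.
by rewrite ler_wpM2r ?(ltW u0)// lerDr ltW.
Qed.

End DistanceComparison.

(** * The singular equation *)

Section SingularEquation.
Context {R : realType} {N : nat}.
Local Notation E := 'rV[R]_N.
Variable Omega : set E.
Hypothesis N0 : (0 < N)%N.
Hypothesis oOmega : open Omega.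
Hypothesis bOmega : bounded_set Omega.
Hypothesis nOmega : Omega !=set0.
Local Notation d := (bdist Omega).
Variables (alpha beta gam : R) (u : E -> R).
Hypothesis gamE : beta + gam * alpha = 2 - gam.
Hypothesis u_gt0 : forall x, Omega x -> 0 < u x.
Hypothesis ur : bdd_continuous_on Omega u.
Local Notation f := (fun x => 1 / (d x `^ beta * u x `^ alpha)).

Lemma singular_rhs_continuous x : Omega x -> {for x, continuous f}.
Proof.
move=> Ox; have dx := bdist_gt0 N0 oOmega bOmega nOmega Ox; have ux := u_gt0 Ox.
apply: (@cts_scalef R E 1 (fun x => (d x `^ beta * u x `^ alpha)^-1)).
apply: (@continuous_comp E R R (fun x => d x `^ beta * u x `^ alpha) GRing.inv).
  apply: (@cts_mulf R E).
    apply: (@continuous_comp E R R d (fun t => t `^ beta)); last exact: continuous_powR.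
    exact: continuous_bdist.
  apply: (@continuous_comp E R R u (fun t => t `^ alpha)); last exact: continuous_powR.
  exact: ur.1.
by apply: inv_continuous; rewrite gt_eqF// mulr_gt0// powR_gt0.
Qed.

(** The scaling argument: on the cube of half side d x / (2 N), which lies in the
ball of radius d x / 2, all quantities are comparable to powers of d x, and the
hypothesis on gam says that the right-hand side scales like u / (d x)^2. *)
Lemma singular_gradient L : 0 < L ->
  (forall x, Omega x -> within_factor L (u x) (d x `^ gam)) ->
  distributional_poisson Omega u f ->
  exists2 c, 0 < c & forall x, Omega x ->
    differentiable u x /\ enorm (grad u x) <= c * d x `^ (gam - 1).
Proof.
move=> L0 hL up.
have N0' : 0 < N%:R :> R by rewrite ltr0n.
pose A := L * 2 `^ `|gam|.
have A0 : 0 < A by rewrite mulr_gt0// powR_gt0.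
pose K := 2 `^ `|beta| * A `^ `|alpha|.
have K0 : 0 < K by rewrite mulr_gt0// powR_gt0.
pose c := N%:R * A * (2 * N%:R) + K / (4 * N%:R).
have c0 : 0 < c.
  by apply: addr_gt0; [|apply: divr_gt0 => //]; do ?apply: mulr_gt0.
exists (N%:R * c); first exact: mulr_gt0.
move=> x Ox; have dx := bdist_gt0 N0 oOmega bOmega nOmega Ox.
pose s := d x / (2 * N%:R).
have s0 : 0 < s by rewrite divr_gt0// mulr_gt0.
have Ns : N%:R * s = d x / 2 by rewrite /s; field; rewrite gt_eqF.
have sub : cube x s `<=` Omega by apply: cube_in_domain => //; rewrite Ns; lra.
have dG : 0 < d x `^ gam by exact: powR_gt0.
have hd y : cube x s y -> within_factor 2 (d y) (d x).
  by move=> xy; apply: dist_comparable_cube xy => //; rewrite Ns.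
have hu y : cube x s y -> within_factor A (u y) (d x `^ gam).
  move=> xy; have Oy := sub y xy; have dy := bdist_gt0 N0 oOmega bOmega nOmega Oy.
  apply: (within_factor_trans (b := d y `^ gam)) (hL y Oy) _; [exact: ltW|exact: powR_ge0|].
  by apply: within_factor_powR => //; exact: hd.
have huM y : cube x s y -> `|u y| <= A * d x `^ gam.
  by move=> xy; rewrite gtr0_norm ?(hu y xy).1//; exact/u_gt0/sub.
have hf y : cube x s y -> `|f y| <= K * d x `^ (gam - 2).
  move=> xy; have Oy := sub y xy; have dy := bdist_gt0 N0 oOmega bOmega nOmega Oy.
  have uy := u_gt0 Oy.
  have h1 := (within_factor_powR beta (ltr0Sn R 1) dy dx (hd y xy)).2.
  have h2 := (within_factor_powR alpha A0 uy dG (hu y xy)).2.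
  have den : 0 < d y `^ beta * u y `^ alpha := mulr_gt0 (powR_gt0 beta dy) (powR_gt0 alpha uy).
  have h3 : d x `^ (2 - gam) <= K * (d y `^ beta * u y `^ alpha).
    rewrite -gamE powRD; last by apply/implyP => _; rewrite gt_eqF.
    rewrite powRrM /K mulrACA; apply: ler_pM => //; exact: powR_ge0.
  rewrite gtr0_norm; last by rewrite divr_gt0.
  have -> : gam - 2 = - (2 - gam) by ring.
  by rewrite powRN ler_pdivrMr// mulrAC ler_pdivlMr ?powR_gt0// mul1r.
have [du hpart] := interior_gradient oOmega bOmega ur singular_rhs_continuous up s0 sub huM hf.
split => //.
have e1 : d x `^ gam = d x `^ (gam - 1) * d x by rewrite powR_subK.
have e2 : d x `^ (gam - 1) = d x `^ (gam - 2) * d x.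
  by rewrite -powR_subK//; congr (_ `^ _ * _); ring.
have e3 : N%:R * (A * d x `^ gam) / s = N%:R * A * (2 * N%:R) * d x `^ (gam - 1).
  by rewrite e1 /s; field; rewrite !gt_eqF.
have e4 : s * (K * d x `^ (gam - 2)) / 2 = K / (4 * N%:R) * d x `^ (gam - 1).
  by rewrite e2 /s; field; rewrite gt_eqF.
apply: le_trans (enorm_le_sum _) _.
apply: (@le_trans _ _ (\sum_(i < N) c * d x `^ (gam - 1))).
  apply: ler_sum => i _; rewrite mxE; apply: le_trans (hpart i) _.
  by rewrite e3 e4 -mulrDl.
by rewrite sumr_const card_ord -[leLHS]mulr_natl mulrA.
Qed.

End SingularEquation.

Theorem lemma4p5 (R : realType) (N : nat) (hN : (0 < N)%N)
    (Omega : set 'rV[R]_N)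
    (hOmega : bounded_domain Omega) (hsmooth : smooth_boundary Omega)
    (lambda1 : R) (phi1 : 'rV[R]_N -> R)
    (hphi1 : positive_first_eigenfunction Omega lambda1 phi1)
    (alpha beta : R)
    (hbeta : 0 <= beta < 2) (hab : 1 < alpha + beta)
    (u : 'rV[R]_N -> R)
    (huC : Cplus Omega (phi_ab alpha beta phi1) u)
    (hu : weak_solution Omega alpha beta u) :
  exists2 c : R, 0 < c &
    forall x, Omega x ->
      differentiable u x /\
      enorm (grad u x) <=
        c * bdist Omega x `^ ((1 - alpha - beta) / (1 + alpha)).
Proof.
have [nO oO _ bO] := hOmega; have [eig _ phi_gt0] := hphi1; have [up _ u_gt0] := hu.
have a0 : 1 + alpha != 0 by move/andP: hbeta => [_ b2]; rewrite gt_eqF//; lra.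
pose gam := (2 - beta) / (1 + alpha).
have gamE : beta + gam * alpha = 2 - gam by rewrite /gam; field.
have -> : (1 - alpha - beta) / (1 + alpha) = gam - 1 by rewrite /gam; field.
have [K K0 hK] := eigenfunction_comparable_dist hN oO bO nO hsmooth eig phi_gt0.
have phic x : Omega x -> {for x, continuous phi1}.
  by case: eig => _ /C2_continuous h _ _ _; exact: h.
have [L L0 hL] := Cplus_comparable hN oO bO nO K0 phi_gt0 phic hK huC.
exact: (singular_gradient hN oO bO nO gamE u_gt0 (C_closure_bdd_continuous oO bO huC.1) L0 hL up).
Qed.
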